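(* Let $\theta_0,\theta_1,\theta_2$ satisfy $0\le\theta_i\le2\pi$, and define $\psi=(\pi-\theta_0-\theta_1-\theta_2)/2$ and $\phi_i=\psi+\theta_i$ for $i\in\{0,1,2\}$. Then there exists a simple arc-triangle whose interior angles at its three vertices (in cyclic order) are $\theta_0,\theta_1,\theta_2$ if and only if $-\pi<\phi_i<\pi$ for all $i\in\{0,1,2\}$.
   Context: An arc-polygon is a cyclic sequence alternating between points (vertices) and closed circular arcs (edges) in the Euclidean plane, each arc appearing consecutively with its two endpoints; straight line segments count as degenerate circular arcs. An arc-triangle has three vertices and three edges. An arc-polygon is simple if the only intersection points between pairs of its edges are shared vertices consecutive with both edges; its edges then form a Jordan curve bounding an interior. The interior angle at a vertex is the angle between the tangent lines of its two incident arcs at that vertex, measured through the interior of the polygon near the vertex (a value in $[0,2\pi]$). *)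

(* Defs.v *)
From HB Require Import structures.
From mathcomp Require Import all_boot all_order all_algebra.
From mathcomp Require Import all_classical all_reals all_analysis.
Set Implicit Arguments. Unset Strict Implicit. Unset Printing Implicit Defensive.
Import Order.TTheory GRing.Theory Num.Theory.
Import numFieldNormedType.Exports.
Local Open Scope classical_set_scope.
Local Open Scope ring_scope.

Section ArcPolygons.
Variable R : realType.

Definition pt := (R * R)%type.

(* A closed circular arc (edge), given by a parametrization on [0,1]:
   - Seg p q : the straight segment from p to q (degenerate circular arc);
   - Circ c r a s : the circle arc t |-> c + r (cos (a + t s), sin (a + t s)),
     t in [0,1], of center c, radius r, starting angle a and signed sweep s. *)
Inductive carc := Seg of pt & pt | Circ of pt & R & R & R.

Definition arc_pt (A : carc) (t : R) : pt :=
  match A with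
  | Seg p q => (p.1 + t * (q.1 - p.1), p.2 + t * (q.2 - p.2))
  | Circ c r a s => (c.1 + r * cos (a + t * s), c.2 + r * sin (a + t * s))
  end.

Definition arc_tan (A : carc) (t : R) : pt :=
  match A with
  | Seg p q => (q.1 - p.1, q.2 - p.2)
  | Circ c r a s => (- (r * s) * sin (a + t * s), (r * s) * cos (a + t * s))
  end.

Definition wf_arc (A : carc) : Prop :=
  match A with
  | Seg p q => p <> q
  | Circ c r a s => 0 < r /\ 0 < `|s| < 2 * pi
  end.

Definition arc_set (A : carc) : set pt := arc_pt A @` `[0, 1].

Definition bounded_pt (S : set pt) : Prop :=
  exists M : R, forall y, S y -> `|y.1| <= M /\ `|y.2| <= M.

(* interior of a closed curve C: union of the bounded connected components
   of its complement (for a Jordan curve: the bounded component). *)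
Definition interior_of (C : set (R * R)%type) : set (R * R)%type :=
  [set x | ~ C x /\ bounded_pt (connected_component (~` C) x)].

Definition rot (al : R) (u : pt) : pt :=
  (u.1 * cos al - u.2 * sin al, u.1 * sin al + u.2 * cos al).

Definition ray_pt (v : pt) (t : R) (u : pt) : pt := (v.1 + t * u.1, v.2 + t * u.2).

(* The sector from direction u counterclockwise to direction w, of angle th,
   is the part of the region X seen from v near v. *)
Definition sector_angle (X : set pt) (v u w : pt) (th : R) : Prop :=
  (exists k : R, 0 < k /\ w = (k * (rot th u).1, k * (rot th u).2)) /\
  (forall al, 0 < al < th ->
     exists e : R, 0 < e /\ forall t, 0 < t < e -> X (ray_pt v t (rot al u))) /\
  (forall al, th < al < 2 * pi ->
     exists e : R, 0 < e /\ forall t, 0 < t < e -> ~ X (ray_pt v t (rot al u))).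

Definition interior_angle (X : set pt) (v d1 d2 : pt) (th : R) : Prop :=
  0 <= th <= 2 * pi /\ (sector_angle X v d1 d2 th \/ sector_angle X v d2 d1 th).

Definition arc_triangle (v0 v1 v2 : pt) (e0 e1 e2 : carc) : Prop :=
  [/\ wf_arc e0, wf_arc e1 & wf_arc e2] /\
  [/\ arc_pt e0 0 = v0 /\ arc_pt e0 1 = v1, arc_pt e1 0 = v1 /\ arc_pt e1 1 = v2
    & arc_pt e2 0 = v2 /\ arc_pt e2 1 = v0].

(* simplicity: edges only meet at the shared (consecutive) vertices; every
   pair of edges of a triangle is consecutive. *)
Definition simple_triangle (v0 v1 v2 : pt) (e0 e1 e2 : carc) : Prop :=
  arc_set e0 `&` arc_set e1 = [set v1] /\
  arc_set e1 `&` arc_set e2 = [set v2] /\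
  arc_set e2 `&` arc_set e0 = [set v0].

Definition neg_pt (u : pt) : pt := (- u.1, - u.2).

Definition triangle_angles (v0 v1 v2 : pt) (e0 e1 e2 : carc) (th0 th1 th2 : R) :
  Prop :=
  let X := interior_of (arc_set e0 `|` arc_set e1 `|` arc_set e2) in
  [/\ interior_angle X v0 (arc_tan e0 0) (neg_pt (arc_tan e2 1)) th0,
      interior_angle X v1 (arc_tan e1 0) (neg_pt (arc_tan e0 1)) th1 &
      interior_angle X v2 (arc_tan e2 0) (neg_pt (arc_tan e1 1)) th2].

End ArcPolygons.

(* Main.v *)
Require Import Defs.
From HB Require Import structures.
From mathcomp Require Import all_boot all_order all_algebra.
From mathcomp Require Import all_classical all_reals all_analysis.
From mathcomp Require Import complex ring lra.
Set Implicit Arguments. Unset Strict Implicit. Unset Printing Implicit Defensive.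
Import Order.TTheory GRing.Theory Num.Theory.
Import numFieldNormedType.Exports.
Local Open Scope classical_set_scope.
Local Open Scope ring_scope.
Local Open Scope complex_scope.

(* Let phi_i be the angle in ]-pi, pi[ between the circumcircle of the vertices and the edge
   opposite to v_i; it is defined because this edge misses v_i. The angle at v_i on the left
   of the oriented curve is pi - phi_j - phi_k modulo 2 pi. An inversion centered at v_i turns
   the two edges at v_i into rays from v_j and v_k that make angles phi_k and phi_j with the
   line v_j v_k, and these rays are disjoint iff |phi_j + phi_k| <= pi. So
   simplicity pins all left angles down exactly, and it remains to see that the interior lies
   on the same side at all corners. An arc from v_i to v_j slightly rotated from the edge
   avoids the curve unless the angle at one end on that side is 0, so it carries membership in
   the interior from one corner to the next; and the left angles 0 and 2 pi cannot both occur.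
   Conversely, take a Euclidean triangle with angles A_i and replace the side opposite to v_i
   by the arc bulging by A_i - phi_i, which is possible when A_i < pi + phi_i. The winding
   number is 1 to the left of every corner, so these points are interior. The A_i can be chosen so
   that a half-line along a chord escapes to infinity from the right of a corner. *)

(** * Directions in the complex plane *)

Section Cis.
Variable R : realType.
Local Notation C := R[i].
Local Notation Re := (@complex.Re R).
Local Notation Im := (@complex.Im R).
Implicit Types (a b x y : R) (w z : C).

(** If every interior angle is the left angle of its corner, then psi + th_i is f_i; if every one is
    the right angle, it is - f_i. The condition of the theorem does not see this sign. One complex
    number per edge carries the whole geometry, F p q b z = cis (- b) (q - z) conj (p - z): the edge
    is where F lies on the closed negative half-line, f_i is the argument of F at the opposite
    vertex, and b plus the argument of F at z measures how the edge turns around z. Hence membership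
    in the interior is followed along paths between thin sectors at the corners. In the
    construction, if some edge has angles below 2 pi at both ends, its prolonged chord reaches the
    exterior at both, and the third corner follows along an edge. Otherwise two angles are 2 pi,
    nothing is to be shown on the right there, and at most one half-line at the third vertex is
    required. *)

Definition cj z : C := conjc z.
Definition cis a : C := cos a +i* sin a.
Definition sqn z : R := Re z ^+ 2 + Im z ^+ 2.
Definition negray z : Prop := Im z = 0 /\ Re z <= 0.
Definition dirn z a : Prop := exists2 k : R, 0 < k & z = k%:C * cis a.

Lemma complex_ext w z : Re w = Re z -> Im w = Im z -> w = z.
Proof. by case: w => a b; case: z => c d /= -> ->. Qed.

Lemma ReM w z : Re (w * z) = Re w * Re z - Im w * Im z.
Proof. by case: w; case: z. Qed.
Lemma ImM w z : Im (w * z) = Re w * Im z + Im w * Re z.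
Proof. by case: w => a b; case: z => c d /=. Qed.
Lemma ReD w z : Re (w + z) = Re w + Re z.
Proof. by case: w; case: z. Qed.
Lemma ImD w z : Im (w + z) = Im w + Im z.
Proof. by case: w; case: z. Qed.
Lemma ReN w : Re (- w) = - Re w.
Proof. by case: w. Qed.
Lemma ImN w : Im (- w) = - Im w.
Proof. by case: w. Qed.
Lemma ReJ w : Re (cj w) = Re w.
Proof. by case: w. Qed.
Lemma ImJ w : Im (cj w) = - Im w.
Proof. by case: w. Qed.
Lemma Re0 : Re (0 : C) = 0. Proof. by []. Qed.
Lemma Im0 : Im (0 : C) = 0. Proof. by []. Qed.
Lemma Re1 : Re (1 : C) = 1. Proof. by []. Qed.
Lemma Im1 : Im (1 : C) = 0. Proof. by []. Qed.
Definition reim := (ReM, ImM, ReD, ImD, ReN, ImN, ReJ, ImJ, Re0, Im0, Re1, Im1).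

Lemma cisD a b : cis (a + b) = cis a * cis b.
Proof. by apply: complex_ext; rewrite !reim /= ?cosD ?sinD //; ring. Qed.
Lemma cis0 : cis 0 = 1.
Proof. by rewrite /cis cos0 sin0. Qed.
Lemma cispi : cis pi = -1.
Proof. by apply: complex_ext; rewrite !reim /= ?cospi ?sinpi ?oppr0. Qed.
Lemma cis2pi : cis (2 * pi) = 1.
Proof.
have -> : 2 * pi = pi + pi :> R by ring.
by rewrite cisD cispi mulrNN mulr1.
Qed.
Lemma cisN a : cis (- a) = cj (cis a).
Proof. by apply: complex_ext; rewrite !reim /= ?cosN ?sinN. Qed.
Lemma cisNK a : cis (- a) * cis a = 1.
Proof. by rewrite -cisD addNr cis0. Qed.
Lemma cisKN a : cis a * cis (- a) = 1.
Proof. by rewrite mulrC cisNK. Qed.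
Lemma cis_neq0 a : cis a != 0.
Proof.
by apply/eqP => h; have := cisNK a; rewrite h mulr0 => /eqP; rewrite eq_sym oner_eq0.
Qed.
Lemma cisDpi a : cis (a + pi) = - cis a.
Proof. by rewrite cisD cispi mulrN1. Qed.
Lemma cisD2pi a : cis (a + 2 * pi) = cis a.
Proof. by rewrite cisD cis2pi mulr1. Qed.
Lemma cisB2pi a : cis (a - 2 * pi) = cis a.
Proof. by rewrite -cisD2pi subrK. Qed.

Lemma sqn_ge0 z : 0 <= sqn z.
Proof. by rewrite addr_ge0 ?sqr_ge0. Qed.
Lemma sqn_gt0 z : z != 0 -> 0 < sqn z.
Proof.
move=> z0; rewrite lt_neqAle sqn_ge0 andbT eq_sym /sqn.
rewrite paddr_eq0 ?sqr_ge0 // !sqrf_eq0; apply: contra z0 => /andP[/eqP h1 /eqP h2].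
by apply/eqP; apply: complex_ext.
Qed.
Lemma mulCJ z : z * cj z = (sqn z)%:C.
Proof. by apply: complex_ext; rewrite !reim /sqn /= ?expr2; ring. Qed.
Lemma conj_real x : cj (x%:C) = x%:C.
Proof. by apply: complex_ext; rewrite !reim /= ?oppr0. Qed.
Lemma conjM w z : cj (w * z) = cj w * cj z.
Proof. by apply: complex_ext; rewrite !reim; ring. Qed.
Lemma conjD w z : cj (w + z) = cj w + cj z.
Proof. by apply: complex_ext; rewrite !reim //; ring. Qed.
Lemma conjN w : cj (- w) = - cj w.
Proof. by apply: complex_ext; rewrite !reim. Qed.
Lemma conjK w : cj (cj w) = w.
Proof. by apply: complex_ext; rewrite !reim ?opprK. Qed.
Lemma conj_cis a : cj (cis a) = cis (- a).
Proof. by rewrite cisN. Qed.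
Lemma conj_eq0 w : (cj w == 0) = (w == 0).
Proof.
apply/eqP/eqP => [h|->]; last by apply: complex_ext; rewrite !reim ?oppr0.
by rewrite -(conjK w) h; apply: complex_ext; rewrite !reim ?oppr0.
Qed.
Lemma sqnM w z : sqn (w * z) = sqn w * sqn z.
Proof. by rewrite /sqn !reim; ring. Qed.
Lemma sqn_cis a : sqn (cis a) = 1.
Proof. by rewrite /sqn /= cos2Dsin2. Qed.
Lemma sqn_real x : sqn (x%:C) = x ^+ 2.
Proof. by rewrite /sqn /= expr0n /= addr0. Qed.
Lemma RCM x y : (x * y)%:C = x%:C * y%:C :> C.
Proof. by rewrite rmorphM. Qed.
Lemma RCD x y : (x + y)%:C = x%:C + y%:C :> C.
Proof. by rewrite rmorphD. Qed.
Lemma RCV x : (x^-1)%:C = (x%:C)^-1 :> C.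
Proof. by rewrite fmorphV. Qed.
Lemma RC_neq0 x : (x%:C != 0 :> C) = (x != 0).
Proof. by apply/negbLR; rewrite negbK; apply/eqP/eqP => [/complexI|->]. Qed.

Lemma negrayP z : negray z <-> exists2 x, 0 <= x & z = - x%:C.
Proof.
split=> [[i0 r0]|[x x0 ->]]; last by rewrite /negray !reim /= oppr0 oppr_le0.
by exists (- Re z); rewrite ?oppr_ge0 //; apply: complex_ext; rewrite !reim /= ?opprK ?oppr0.
Qed.
Lemma negrayZ k z : 0 < k -> negray (k%:C * z) <-> negray z.
Proof.
move=> k0; rewrite /negray !reim /= !mul0r subr0 addr0 pmulr_rle0 //.
split=> -[h ?]; split => //; last by rewrite h mulr0.
by apply/eqP; move/eqP: h; rewrite mulf_eq0 (gt_eqF k0).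
Qed.
Lemma negrayJ z : negray (cj z) <-> negray z.
Proof.
rewrite /negray !reim; split=> -[h ?]; split => //; last by rewrite h oppr0.
by apply/eqP; rewrite -oppr_eq0 h.
Qed.

Lemma sin_eq0_lt a : - pi < a < pi -> sin a = 0 -> a = 0.
Proof.
move=> /andP[h1 h2] s0; case: (ltgtP a 0) => // h.
- have := @sin_gt0_pi _ (- a); rewrite sinN s0 oppr0 ltxx => H.
  by have : false by apply: H; apply/andP; split; lra.
- have := @sin_gt0_pi _ a; rewrite s0 ltxx => H.
  by have : false by apply: H; apply/andP; split; lra.
Qed.

(** The half-angle a / 2 lies in ]-pi, pi[, and cos a = 1 - 2 sin (a / 2) ^ 2 forces its sine to
    vanish. *)
Lemma cis_eq1 a : - (2 * pi) < a < 2 * pi -> cis a = 1 -> a = 0.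
Proof.
move=> /andP[h1 h2] [ca _].
have sh : sin (a / 2) = 0.
  have := cos_mulr2n (a / 2); rewrite cos2sin2.
  have -> : a / 2 *+ 2 = a by rewrite -mulr_natr; field.
  rewrite ca => h; apply/eqP; rewrite -sqrf_eq0; apply/eqP; lra.
have := @sin_eq0_lt (a / 2); rewrite sh => H.
suff : a / 2 = 0 by lra.
by apply: H => //; apply/andP; split; lra.
Qed.

Lemma dirn_cis_eq z a b : dirn z a -> dirn z b -> cis a = cis b.
Proof.
move=> [k k0 ->] [l l0 h].
have kl : k = l.
  have := congr1 sqn h; rewrite !sqnM !sqn_cis !sqn_real !mulr1 => /eqP.
  by rewrite eqrXn2 ?ltW // => /eqP.
by subst l; apply: (mulfI (x := k%:C)) => //; rewrite RC_neq0 gt_eqF.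
Qed.

Lemma dirn_inj z a b : dirn z a -> dirn z b -> - (2 * pi) < a - b < 2 * pi -> a = b.
Proof.
move=> da db ab; have : a - b = 0.
  by apply: cis_eq1 => //; rewrite cisD (dirn_cis_eq da db) cisKN.
by move/eqP; rewrite subr_eq0 => /eqP.
Qed.

Lemma dirnZ z a k : 0 < k -> dirn z a -> dirn (k%:C * z) a.
Proof.
move=> k0 [l l0 ->]; exists (k * l); rewrite ?mulr_gt0 //.
by rewrite rmorphM mulrA.
Qed.
Lemma dirnM w z a b : dirn w a -> dirn z b -> dirn (w * z) (a + b).
Proof.
move=> [k k0 ->] [l l0 ->]; exists (k * l); rewrite ?mulr_gt0 //.
by rewrite rmorphM cisD; ring.
Qed.
Lemma dirnJ z a : dirn z a -> dirn (cj z) (- a).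
Proof. by move=> [k k0 ->]; exists k => //; rewrite conjM conj_real conj_cis. Qed.
Lemma dirn_cis a : dirn (cis a) a.
Proof. by exists 1 => //; rewrite mul1r. Qed.
Lemma dirn_neq0 z a : dirn z a -> z != 0.
Proof. by move=> [k k0 ->]; rewrite mulf_neq0 ?cis_neq0 // RC_neq0 gt_eqF. Qed.
Lemma dirn_negray z : negray z -> z != 0 -> dirn z pi.
Proof.
move=> /negrayP[x x0 ->] h; exists x; last by rewrite cispi mulrN1.
by rewrite lt_neqAle x0 andbT eq_sym; apply: contra h => /eqP ->; rewrite oppr0.
Qed.
Lemma dirn_not_negray z a : - pi < a < pi -> dirn z a -> ~ negray z.
Proof.
move=> /andP[h1 h2] d n.
have d' := dirn_negray n (dirn_neq0 d).
by have := dirn_inj d d'; rewrite /= => H; have : a = pi by [apply: H; apply/andP; split; lra]; lra.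
Qed.

(** Half-angle formula for the principal argument: one expression, continuous off the closed
    negative half-line. On that half-line Im z = 0 and the value is 0 by default. *)
Definition Arg z : R := 2 * atan (Im z / (Re z + Num.sqrt (sqn z))).

Lemma Arg_bound z : - pi < Arg z < pi.
Proof.
rewrite /Arg; set t := _ / _; have := atan_gtNpi2 t; have := atan_ltpi2 t.
by move=> h1 h2; apply/andP; split; lra.
Qed.

Lemma Arg_den_gt0 z : ~ negray z -> 0 < Re z + Num.sqrt (sqn z).
Proof.
move=> nz; case: (ltP 0 (Re z)) => hr; first by rewrite ltr_wpDr ?sqrtr_ge0.
have i0 : Im z != 0 by apply/eqP => i0; apply: nz.
have s2 : Num.sqrt (sqn z) ^+ 2 = sqn z by rewrite sqr_sqrtr ?sqn_ge0.
have s0 : 0 <= Num.sqrt (sqn z) by rewrite sqrtr_ge0.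
have i2 : 0 < Im z ^+ 2 by rewrite exprn_even_gt0.
rewrite /sqn in s2 s0 *; nra.
Qed.

Lemma Arg_dirn z : ~ negray z -> dirn z (Arg z).
Proof.
move=> nz; have d0 := Arg_den_gt0 nz.
set n := Num.sqrt (sqn z) in d0 *.
have n2 : n ^+ 2 = sqn z by rewrite sqr_sqrtr ?sqn_ge0.
have n0 : 0 < n.
  rewrite sqrtr_gt0 sqn_gt0 //; apply/eqP => z0; apply: nz.
  by rewrite z0 /negray !reim.
exists n => //.
set d := Re z + n in d0; set t := Im z / d.
have at_ : Arg z = atan t *+ 2 by rewrite /Arg mulr_natl.
have c2 : cos (atan t) ^+ 2 = d / (2 * n).
  rewrite cos_atan exprVn sqr_sqrtr; last by rewrite addr_ge0 ?sqr_ge0.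
  have -> : 1 + t ^+ 2 = (2 * n) / d.
    rewrite /t; have dn : d != 0 by rewrite gt_eqF.
    have e : d ^+ 2 + Im z ^+ 2 = 2 * n * d.
      by rewrite /d; move: n2; rewrite /sqn => n2; ring: n2.
    have -> : 1 + (Im z / d) ^+ 2 = (d ^+ 2 + Im z ^+ 2) / d ^+ 2 by field.
    by rewrite e; field.
  by rewrite invf_div.
have sc : sin (atan t) = t * cos (atan t).
  have c0 : cos (atan t) != 0.
    rewrite gt_eqF // cos_gt0_pihalf // atan_gtNpi2 //= atan_ltpi2 //.
  have : tan (atan t) * cos (atan t) = sin (atan t) by rewrite /tan divfK.
  by rewrite atanK.
have nn : n != 0 by rewrite gt_eqF.
have dn : d != 0 by rewrite gt_eqF.
apply: complex_ext; rewrite !reim /= at_ ?cos_mulr2n ?sin_mulr2n ?sc mul0r ?subr0 ?addr0.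
  rewrite c2 -mulr_natl /d; field; exact: nn.
have -> : cos (atan t) * (t * cos (atan t)) *+ 2 = t * cos (atan t) ^+ 2 * 2.
  by rewrite -mulr_natr; ring.
by rewrite c2 /t; field; rewrite nn dn.
Qed.

Lemma polar z : z != 0 -> exists a, - pi < a <= pi /\ dirn z a.
Proof.
move=> z0; have [n|n] := pselect (negray z).
  exists pi; split; first by have := pi_gt0 R => h; apply/andP; split; lra.
  exact: dirn_negray.
exists (Arg z); split; last exact: Arg_dirn.
by have /andP[-> /ltW ->] := Arg_bound z.
Qed.

Lemma ArgE z a : - pi < a < pi -> dirn z a -> Arg z = a.
Proof.
move=> ha d; have n := dirn_not_negray ha d.
apply: (dirn_inj (Arg_dirn n) d).
by move/andP: (Arg_bound z) => [? ?]; move/andP: ha => [? ?]; apply/andP; split; lra.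
Qed.

(* The cone spanned by two directions less than a half-turn apart misses the positive reals. *)
Lemma wedge A B x y : 0 < x < 2 * pi -> 0 <= y <= 2 * pi -> - pi < y - x < pi ->
  0 < A -> 0 <= B -> ~ (Im (A%:C * cis x + B%:C * cis y) = 0 /\ 0 <= Re (A%:C * cis x + B%:C * cis y)).
Proof.
move=> /andP[x1 x2] /andP[y1 y2] /andP[d1 d2] A0 B0.
rewrite !reim /= !mul0r !subr0 !addr0 => -[im re].
have sxy : sin (x - y) = sin x * cos y - cos x * sin y by rewrite sinB.
(* Im = 0 eliminates A. Below, the signs of sin x and sin (x - y) are shown to contradict a
   nonnegative real part. *)
have key : sin x * (A * cos x + B * cos y) = B * sin (x - y).
  rewrite sxy; have := congr1 ( *%R (cos x)) im; rewrite mulr0; lra.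
have spos t : pi < t < 2 * pi -> sin t < 0.
  move=> /andP[? ?]; have := @sin_gt0_pi _ (t - pi).
  have -> : sin (t - pi) = - sin t by rewrite sinB cospi sinpi; ring.
  rewrite oppr_gt0; apply; apply/andP; split; lra.
case: (ltgtP x pi) => hx.
- have sx : 0 < sin x by apply: sin_gt0_pi; rewrite x1.
  have Bp : 0 < B.
    by rewrite lt_neqAle B0 andbT; apply/eqP => b0; move: im; rewrite -b0; nra.
  have sy : sin y < 0 by nra.
  have yp : pi < y.
    by rewrite ltNge; apply/negP => h; have := @sin_ge0_pi _ y; rewrite y1 h => /(_ isT); lra.
  have := @sin_gt0_pi _ (y - x); rewrite -opprB sinN => H.
  have : 0 < - sin (x - y) by apply: H; apply/andP; split; lra.
  by nra.
- have sx : sin x < 0 by apply: spos; rewrite hx.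
  have Bp : 0 < B.
    by rewrite lt_neqAle B0 andbT; apply/eqP => b0; move: im; rewrite -b0; nra.
  have sy : 0 < sin y by nra.
  have yp : y < pi.
    rewrite ltNge; apply/negP => h; have := @sin_ge0_pi _ (y - pi).
    have -> : sin (y - pi) = - sin y by rewrite sinB cospi sinpi; ring.
    by move=> H; have : 0 <= - sin y by [apply: H; apply/andP; split; lra]; lra.
  have : 0 < sin (x - y) by apply: sin_gt0_pi; apply/andP; split; lra.
  by nra.
- subst x; rewrite sinpi cospi in im re.
  have [B_0|Bn] := eqVneq B 0; first by rewrite B_0 in re; lra.
  have sy : sin y = 0.
    by apply/eqP; move/eqP: im; rewrite mulr0 add0r mulf_eq0 (negbTE Bn).
  have : y - pi = 0.
    by apply: sin_eq0_lt; [apply/andP; split; lra|rewrite sinB cospi sinpi sy; ring].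
  move=> ye; have ye' : y = pi by lra.
  by rewrite ye' cospi in re; lra.
Qed.

End Cis.

(** * Circular arcs through two points *)

Section AbstractArcs.
Variable R : realType.
Local Notation C := R[i].
Local Notation Re := (@complex.Re R).
Local Notation Im := (@complex.Im R).
Implicit Types (a b r t x y : R) (p q w z : C).

(* The arc from p to q whose tangent at p is the chord turned by -b: by the inscribed angle
   theorem it is the locus F p q b z <= 0. *)
Definition F p q b z : C := cis (- b) * (q - z) * cj (p - z).
Definition onarc p q b z : Prop := negray (F p q b z).
(* apt parametrizes the arc by the angle between the tangent at p and the chord p z; chord is
   the resulting ratio |z - p| / |q - p|. *)
Definition chord b t : R := if b == 0 then t else sin (t * b) / sin b.
Definition out p q b : C := cis (- b) * (q - p).
Definition apt p q b t : C := p + (q - p) * (chord b t)%:C * cis (- ((1 - t) * b)).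

(** In the frame of the tangent at p, and up to a positive factor when r > 0, F is - cis (- a)
    perturbed by r cis (- b): close to p its argument tends to pi - a. *)
Lemma F_start p q b r a : F p q b (p + r%:C * (cis a * out p q b)) =
  (r * sqn (out p q b))%:C * (r%:C * cis (- b) - cis (- a)).
Proof.
have [d dE] : exists d, d = out p q b by exists (out p q b).
rewrite -dE /F.
have -> : p - (p + r%:C * (cis a * d)) = - (r%:C * (cis a * d)) by ring.
rewrite !(conjN, conjM) conj_real conj_cis RCM -mulCJ.
have -> : cis (- b) * (q - (p + r%:C * (cis a * d))) = d - cis (- b) * r%:C * (cis a * d).
  by rewrite {2}dE /out; ring.
transitivity (r%:C * (d * cj d) * (r%:C * cis (- b) * (cis a * cis (- a)) - cis (- a))); first by ring.
by rewrite cisKN mulr1.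
Qed.

Lemma F_rev p q b z : F q p (- b) z = cj (F p q b z).
Proof. by rewrite /F !conjM conjK conj_cis opprK; ring. Qed.

Lemma onarc_rev p q b z : onarc q p (- b) z <-> onarc p q b z.
Proof. by rewrite /onarc F_rev negrayJ. Qed.

Lemma onarc_start p q b : onarc p q b p.
Proof. by rewrite /onarc /F subrr (_ : cj 0 = 0) ?mulr0 ?/negray ?reim //; apply/eqP; rewrite conj_eq0. Qed.
Lemma onarc_end p q b : onarc p q b q.
Proof. by rewrite -onarc_rev; apply: onarc_start. Qed.

Lemma chord0 b : chord b 0 = 0.
Proof. by rewrite /chord; case: ifP => // _; rewrite mul0r sin0 mul0r. Qed.

Lemma sin_neq0 b : - pi < b < pi -> b != 0 -> sin b != 0.
Proof. by move=> hb b0; apply: contra b0 => /eqP /(sin_eq0_lt hb) ->. Qed.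

Lemma chord_gt0 b t : - pi < b < pi -> 0 < t <= 1 -> 0 < chord b t.
Proof.
move=> hb /andP[t0 t1]; rewrite /chord; case: eqVneq => // b0.
move/andP: (hb) => [b1 b2].
case: (ltgtP b 0) b0 => // bs _.
  rewrite -mulrNN -invrN -!sinN mulr_gt0 ?invr_gt0 // sin_gt0_pi //.
    by rewrite -mulrN; apply/andP; split; nra.
  by apply/andP; split; lra.
rewrite mulr_gt0 ?invr_gt0 // sin_gt0_pi //; apply/andP; split; nra.
Qed.

Lemma chord_ge0 b t : - pi < b < pi -> 0 <= t <= 1 -> 0 <= chord b t.
Proof.
move=> hb /andP[t0 t1]; case: (ltgtP t 0) t0 => // [h _|-> _]; last by rewrite chord0.
by apply/ltW/chord_gt0 => //; rewrite h.
Qed.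

(** The vectors from p to z and from z to q, divided by q - p, add up to 1: the law of sines in the
    triangle p, z, q. *)
Lemma chord_split b t : - pi < b < pi ->
  (chord b t)%:C * cis (- ((1 - t) * b)) + (chord b (1 - t))%:C * cis (t * b) = 1 :> C.
Proof.
move=> hb; rewrite /chord; case: eqVneq => [->|b0].
  by rewrite !mulr0 oppr0 cis0 !mulr1; apply: complex_ext; rewrite !reim /=; ring.
have s0 := sin_neq0 hb b0.
have sb : sin b = sin (t * b) * cos ((1 - t) * b) + cos (t * b) * sin ((1 - t) * b).
  by rewrite -sinD; congr sin; ring.
apply: complex_ext; rewrite !reim /= ?cosN ?sinN; last by field.
apply: (mulIf s0); rewrite mul1r [RHS]sb; field; exact: s0.
Qed.

Lemma start_sub_apt p q b t :
  p - apt p q b t = - (q - p) * (chord b t)%:C * cis (- ((1 - t) * b)).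
Proof. by rewrite /apt; ring. Qed.
Lemma end_sub_apt p q b t : - pi < b < pi ->
  q - apt p q b t = (q - p) * (chord b (1 - t))%:C * cis (t * b).
Proof.
move=> hb; have h := chord_split t hb.
have -> : q - apt p q b t = (q - p) * (1 - (chord b t)%:C * cis (- ((1 - t) * b))).
  by rewrite /apt; ring.
by rewrite -{1}h; ring.
Qed.

Lemma apt0 p q b : apt p q b 0 = p.
Proof. by rewrite /apt chord0 mulr0 mul0r addr0. Qed.
Lemma aptE_start p q b t :
  apt p q b t = p + (chord b t)%:C * cis (t * b) * (cis (- b) * (q - p)).
Proof.
rewrite /apt; congr (_ + _).
have -> : - ((1 - t) * b) = t * b + - b by ring.
by rewrite cisD; ring.
Qed.
Lemma aptE_end p q b t : - pi < b < pi ->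
  apt p q b t = q + (chord b (1 - t))%:C * cis (- ((1 - t) * b)) * (cis b * (p - q)).
Proof.
move=> hb; have := end_sub_apt p q t hb => h.
have -> : apt p q b t = q - (q - apt p q b t) by ring.
rewrite h; have -> : t * b = - ((1 - t) * b) + b by ring.
by rewrite cisD; ring.
Qed.

Lemma F_apt p q b t : - pi < b < pi ->
  F p q b (apt p q b t) = - (sqn (q - p) * (chord b t * chord b (1 - t)))%:C.
Proof.
move=> hb; rewrite /F end_sub_apt // start_sub_apt.
have e : cis (- b) * (cis (t * b) * cj (cis (- ((1 - t) * b)))) = 1 :> C.
  by rewrite conj_cis opprK -!cisD (_ : - b + (t * b + (1 - t) * b) = 0) ?cis0 //; ring.
rewrite !conjM conjN conj_real !RCM -mulCJ.
transitivity (- ((q - p) * cj (q - p) * ((chord b t)%:C * (chord b (1 - t))%:C)) *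
  (cis (- b) * (cis (t * b) * cj (cis (- ((1 - t) * b)))))); first by ring.
by rewrite e mulr1.
Qed.

Lemma apt_onarc p q b t : - pi < b < pi -> 0 <= t <= 1 -> onarc p q b (apt p q b t).
Proof.
move=> hb /andP[t0 t1]; rewrite /onarc F_apt //; apply/negrayP.
exists (sqn (q - p) * (chord b t * chord b (1 - t))) => //.
rewrite !mulr_ge0 ?sqn_ge0 // chord_ge0 // ?t0 //.
by apply/andP; split; lra.
Qed.

Lemma apt_neq_start p q b t : p != q -> - pi < b < pi -> 0 < t <= 1 -> apt p q b t != p.
Proof.
move=> pq hb ht; rewrite -subr_eq0 /apt addrC addKr !mulf_neq0 ?cis_neq0 //.
  by rewrite subr_eq0 eq_sym.
by rewrite RC_neq0 gt_eqF // chord_gt0.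
Qed.
Lemma apt_neq_end p q b t : p != q -> - pi < b < pi -> 0 <= t < 1 -> apt p q b t != q.
Proof.
move=> pq hb /andP[t0 t1]; rewrite eq_sym -subr_eq0 end_sub_apt // !mulf_neq0 ?cis_neq0 //.
  by rewrite subr_eq0 eq_sym.
by rewrite RC_neq0 gt_eqF // chord_gt0 //; apply/andP; split; lra.
Qed.

(** For z on the locus other than p, q - z = - k cis b (p - z), where k is the ratio of the
    distances of z to q and to p. A parameter t with the same k yields a point with the same
    equation, whose solution is unique since 1 + k cis b = 0 would give p = q. *)
Lemma onarcP p q b z : p != q -> - pi < b < pi ->
  onarc p q b z <-> exists2 t, 0 <= t <= 1 & z = apt p q b t.
Proof.
move=> pq hb; split; last by move=> [t t01 ->]; exact: apt_onarc.
move=> h; have [->|zp] := eqVneq z p.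
  by exists 0; rewrite ?apt0 // lexx ler01.
have pz0 : p - z != 0 by rewrite subr_eq0 eq_sym.
have [x x0 Fz] := (negrayP _).1 h.
have s0 := sqn_gt0 pz0.
have qz : q - z = - (x / sqn (p - z))%:C * cis b * (p - z).
  have e1 : (q - z) * (sqn (p - z))%:C = - x%:C * cis b * (p - z).
    rewrite -Fz /F -mulCJ; transitivity ((q - z) * ((p - z) * cj (p - z)) * (cis (- b) * cis b)).
      by rewrite cisNK mulr1.
    by ring.
  have sn : (sqn (p - z))%:C != 0 :> C by rewrite RC_neq0 gt_eqF.
  apply: (mulIf sn); rewrite e1 RCM RCV.
  by field.
set k := x / sqn (p - z) in qz.
have k0 : 0 <= k by rewrite divr_ge0 // ltW.
(* By the law of sines the parameter is determined by the ratio k of the distances to q and p. *)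
have [t [t0 t1] ht] : exists2 t, 0 < t /\ t <= 1 & chord b (1 - t) = k * chord b t.
  have [->|b0] := eqVneq b 0.
    have k1 : 0 < 1 + k by rewrite ltr_wpDr.
    exists (1 + k)^-1; first by rewrite invr_gt0 invf_le1 ?lerDl.
    by rewrite /chord eqxx; field; rewrite gt_eqF.
  have [t /andP[t0 t1] /eqP ht] : exists2 t, 0 <= t <= 1 & sin ((1 - t) * b) - k * sin (t * b) == 0.
    pose g t := sin ((1 - t) * b) - k * sin (t * b).
    have gc : {within `[0, 1], continuous g}.
      apply: continuous_subspaceT => y; apply: cvgB.
        apply: (@continuous_comp _ _ _ (fun y => (1 - y) * b) sin); last exact: continuous_sin.
        by apply: cvgMl; apply: cvgB => //; apply: cvg_cst.
      apply: cvgMr; apply: (@continuous_comp _ _ _ (fun y => y * b) sin); last exact: continuous_sin.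
      exact: cvgMl.
    have g0 : g 0 = sin b by rewrite /g mul0r sin0 mulr0 !subr0 mul1r.
    have g1 : g 1 = - (k * sin b) by rewrite /g subrr mul0r sin0 mul1r sub0r.
    have [|t ht gt] := @IVT _ g 0 1 0 ler01 gc.
      rewrite g0 g1 ge_min le_max; have [h1|h1] := leP 0 (sin b).
        have h2 : - (k * sin b) <= 0 by rewrite oppr_le0 mulr_ge0.
        by rewrite h2 ?orbT.
      have h2 : 0 <= - (k * sin b) by rewrite oppr_ge0 nmulr_lle0.
      by rewrite h2 (ltW h1) ?orbT.
    exists t; first by move: ht; rewrite in_itv.
    by rewrite -[X in X == 0]/(g t) gt.
  have sb0 := sin_neq0 hb b0.
  have tn : t != 0.
    apply/eqP => t_0; move: ht; rewrite t_0 mul0r sin0 mulr0 !subr0 mul1r => s1.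
    by move: sb0; rewrite s1 eqxx.
  exists t; first by split => //; rewrite lt_neqAle eq_sym tn t0.
  by rewrite /chord (negbTE b0) mulrA; congr (_ / _); apply/eqP; rewrite -subr_eq0 ht eqxx.
exists t; first by rewrite (ltW t0) t1.
have hat := end_sub_apt p q t hb.
have ct := chord_gt0 hb (introT andP (conj t0 t1)).
set z' := apt p q b t in hat *.
have qz' : q - z' = - k%:C * cis b * (p - z').
  rewrite hat start_sub_apt ht RCM (_ : t * b = b + - ((1 - t) * b)); last by ring.
  by rewrite cisD; ring.
have : (q - p) = (1 + k%:C * cis b) * (z - p).
  have -> : q - p = (q - z) - (p - z) by ring.
  by rewrite qz; ring.
have -> : (q - p) = (1 + k%:C * cis b) * (z' - p).
  have -> : q - p = (q - z') - (p - z') by ring.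
  by rewrite qz'; ring.
move=> e; suff D : 1 + k%:C * cis b != 0.
  by move/(mulfI D): e => /addIr.
apply/eqP => D; move/eqP: pq; apply; apply/esym/eqP; rewrite -subr_eq0.
have -> : q - p = (q - z) - (p - z) by ring.
apply/eqP; rewrite qz; transitivity ((1 + k%:C * cis b) * (z - p)); first by ring.
by rewrite D mul0r.
Qed.

End AbstractArcs.

(** * Angles of an arc-triangle with its circumcircle *)

Section Triangle.
Variable R : realType.
Local Notation C := R[i].
Local Notation Re := (@complex.Re R).
Local Notation Im := (@complex.Im R).

(* f_i is the angle, inwards for a counterclockwise triangle, between the circle through the
   vertices and the edge opposite to v_i. *)
Record tri (v0 v1 v2 : C) (b0 b1 b2 f0 f1 f2 : R) : Prop := Tri {
  tri_v01 : v0 != v1; tri_v12 : v1 != v2; tri_v20 : v2 != v0;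
  tri_b0 : - pi < b0 < pi; tri_b1 : - pi < b1 < pi; tri_b2 : - pi < b2 < pi;
  tri_f0 : - pi < f0 < pi; tri_f1 : - pi < f1 < pi; tri_f2 : - pi < f2 < pi;
  tri_F0 : dirn (F v0 v1 b0 v2) f2;
  tri_F1 : dirn (F v1 v2 b1 v0) f0;
  tri_F2 : dirn (F v2 v0 b2 v1) f1 }.

Lemma tri_rot v0 v1 v2 b0 b1 b2 f0 f1 f2 :
  tri v0 v1 v2 b0 b1 b2 f0 f1 f2 -> tri v1 v2 v0 b1 b2 b0 f1 f2 f0.
Proof. by case=> *; split. Qed.

(** Traversing the triangle backwards negates bulges and angles and exchanges the two edges adjacent
    to v0 v1, so a statement about one of them gives the other. *)
Lemma tri_rev v0 v1 v2 b0 b1 b2 f0 f1 f2 :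
  tri v0 v1 v2 b0 b1 b2 f0 f1 f2 ->
  tri v1 v0 v2 (- b0) (- b2) (- b1) (- f1) (- f0) (- f2).
Proof.
have oppI (x : R) : - pi < x < pi -> - pi < - x < pi.
  by move=> /andP[? ?]; apply/andP; split; lra.
case=> *; split; rewrite 1?eq_sym ?F_rev //; try exact: oppI; exact: dirnJ.
Qed.

(** In a [tri] and for x >= 0 the two summands have directions f2 and f2 + f0, so on the second edge
    F of the first edge only takes arguments between these. This is the inversion picture in
    algebraic form. *)
Lemma F_adjacent v0 v1 v2 b0 b1 z (x : R) :
  v1 != v2 -> v2 != v0 -> F v1 v2 b1 z = - x%:C ->
  F v0 v1 b0 z = (sqn (v1 - z) / sqn (v1 - v2))%:C * F v0 v1 b0 v2 +
    (x / (sqn (v1 - v2) * sqn (v2 - v0)))%:C * (F v0 v1 b0 v2 * F v1 v2 b1 v0).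
Proof.
move=> v12 v20 Fz.
have s12 : 0 < sqn (v1 - v2) by rewrite sqn_gt0 // subr_eq0.
have s20 : 0 < sqn (v2 - v0) by rewrite sqn_gt0 // subr_eq0.
have c12 : (sqn (v1 - v2))%:C != 0 :> C by rewrite RC_neq0 gt_eqF.
have c20 : (sqn (v2 - v0))%:C != 0 :> C by rewrite RC_neq0 gt_eqF.
have Fz' : (v1 - z) * cj (v2 - z) = - x%:C * cis (- b1).
  have : cj (F v1 v2 b1 z) = - x%:C by rewrite Fz conjN conj_real.
  rewrite /F !conjM conjK conj_cis opprK => h.
  rewrite -h; transitivity (cis b1 * cis (- b1) * ((v1 - z) * cj (v2 - z))); last by ring.
  by rewrite cisKN mul1r.
(* Ptolemy/Pluecker relation *)
have pl : cj (v0 - z) * cj (v1 - v2) + cj (v1 - z) * cj (v2 - v0) + cj (v2 - z) * cj (v0 - v1) = 0.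
  by rewrite !(conjD, conjN); ring.
have e1 : F v0 v1 b0 z * (sqn (v1 - v2))%:C =
  (sqn (v1 - z))%:C * F v0 v1 b0 v2 + x%:C * (cis (- b0) * cis (- b1) * (v2 - v1) * cj (v1 - v0)).
  rewrite /F -!mulCJ.
  have -> : cis (- b0) * (v1 - z) * cj (v0 - z) * ((v1 - v2) * cj (v1 - v2)) =
     cis (- b0) * (v1 - z) * (v1 - v2) * (cj (v0 - z) * cj (v1 - v2)) by ring.
  have -> : cj (v0 - z) * cj (v1 - v2) = - (cj (v1 - z) * cj (v2 - v0)) - cj (v2 - z) * cj (v0 - v1).
    by rewrite -[RHS]addr0 -pl; ring.
  have -> : cis (- b0) * (v1 - z) * (v1 - v2) * (- (cj (v1 - z) * cj (v2 - v0)) - cj (v2 - z) * cj (v0 - v1))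
    = cis (- b0) * (v1 - v2) * (- ((v1 - z) * cj (v1 - z)) * cj (v2 - v0) - (v1 - z) * cj (v2 - z) * cj (v0 - v1)) by ring.
  by rewrite Fz' !(conjD, conjN); ring.
have e2 : (cis (- b0) * cis (- b1) * (v2 - v1) * cj (v1 - v0)) * (sqn (v2 - v0))%:C =
  F v0 v1 b0 v2 * F v1 v2 b1 v0.
  by rewrite /F -mulCJ !(conjD, conjN); ring.
apply: (mulIf c12); rewrite e1; apply: (mulIf c20).
rewrite mulrDl -(mulrA x%:C) e2 !(RCM, RCV).
by field; rewrite c12 c20.
Qed.

Lemma F_on_adjacent v0 v1 v2 b0 b1 b2 f0 f1 f2 z :
  tri v0 v1 v2 b0 b1 b2 f0 f1 f2 -> onarc v1 v2 b1 z -> z != v1 ->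
  exists A B : R, [/\ 0 < A, 0 <= B &
    F v0 v1 b0 z = A%:C * cis f2 + B%:C * cis (f2 + f0)].
Proof.
case=> v01 v12 v20 _ _ _ _ _ _ [k2 k20 F0] [k0 k00 F1] _ /negrayP[x x0 Fz] zv1.
have s12 : 0 < sqn (v1 - v2) by rewrite sqn_gt0 // subr_eq0.
have s20 : 0 < sqn (v2 - v0) by rewrite sqn_gt0 // subr_eq0.
have s1z : 0 < sqn (v1 - z) by rewrite sqn_gt0 // subr_eq0 eq_sym.
exists (sqn (v1 - z) / sqn (v1 - v2) * k2), (x / (sqn (v1 - v2) * sqn (v2 - v0)) * (k2 * k0)).
split; [by rewrite mulr_gt0 // divr_gt0|by rewrite mulr_ge0 // ?divr_ge0 // ltW // mulr_gt0|].
by rewrite (F_adjacent b0 v12 v20 Fz) F0 F1 cisD !RCM; ring.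
Qed.

Lemma F_on_other_adjacent v0 v1 v2 b0 b1 b2 f0 f1 f2 z :
  tri v0 v1 v2 b0 b1 b2 f0 f1 f2 -> onarc v2 v0 b2 z -> z != v0 ->
  exists A B : R, [/\ 0 < A, 0 <= B &
    F v0 v1 b0 z = A%:C * cis f2 + B%:C * cis (f2 + f1)].
Proof.
move=> /tri_rev T h zv; have h' : onarc v0 v2 (- b2) z by rewrite onarc_rev.
have [A [B [A0 B0 e]]] := F_on_adjacent T h' zv.
exists A, B; split => //.
by rewrite -[LHS]conjK -F_rev e conjD !conjM !conj_real !conj_cis opprD !opprK.
Qed.

(* Modulo 2 pi, c is not between f and f + g. *)
Definition off_range (f g c : R) := 0 < f - c < 2 * pi /\ 0 <= f + g - c <= 2 * pi.

Lemma F_off_dir (f g c A B x : R) : - pi < g < pi -> off_range f g c -> 0 < A -> 0 <= B ->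
  0 <= x -> A%:C * cis f + B%:C * cis (f + g) <> x%:C * cis c.
Proof.
move=> hg [h1 h2] A0 B0 x0 h.
have := @wedge R A B (f - c) (f + g - c) h1 h2 _ A0 B0.
rewrite (_ : f + g - c - (f - c) = g); last by ring.
move/(_ hg); apply.
suff -> : A%:C * cis (f - c) + B%:C * cis (f + g - c) = x%:C by [].
by rewrite (cisD f) (cisD (f + g)) !mulrA -mulrDl h -mulrA cisKN mulr1.
Qed.

Lemma F_adjacent_off v0 v1 v2 b0 b1 b2 f0 f1 f2 z c x :
  tri v0 v1 v2 b0 b1 b2 f0 f1 f2 -> off_range f2 f0 c -> 0 <= x ->
  F v0 v1 b0 z = x%:C * cis c -> onarc v1 v2 b1 z -> z = v1.
Proof.
move=> T h x0 e on; apply/eqP/negPn/negP => zv.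
have [A [B [A0 B0 e']]] := F_on_adjacent T on zv.
by rewrite e' in e; apply: (F_off_dir (tri_f0 T) h A0 B0 x0 e).
Qed.

Lemma F_other_adjacent_off v0 v1 v2 b0 b1 b2 f0 f1 f2 z c x :
  tri v0 v1 v2 b0 b1 b2 f0 f1 f2 -> off_range f2 f1 c -> 0 <= x ->
  F v0 v1 b0 z = x%:C * cis c -> onarc v2 v0 b2 z -> z = v0.
Proof.
move=> T h x0 e on; apply/eqP/negPn/negP => zv.
have [A [B [A0 B0 e']]] := F_on_other_adjacent T on zv.
by rewrite e' in e; apply: (F_off_dir (tri_f1 T) h A0 B0 x0 e).
Qed.

Lemma arcs_meet_once v0 v1 v2 b0 b1 b2 f0 f1 f2 z :
  tri v0 v1 v2 b0 b1 b2 f0 f1 f2 -> - pi <= f2 + f0 <= pi ->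
  onarc v0 v1 b0 z -> onarc v1 v2 b1 z -> z = v1.
Proof.
(* On the first edge F points along - pi; for c = - pi, [off_range] says - pi < f2 < pi and - pi <=
   f2 + f0 <= pi. *)
move=> T /andP[h1 h2] /negrayP[x x0 e]; apply: (F_adjacent_off (c := - pi) T _ x0).
  by have /andP[? ?] := tri_f2 T; split; apply/andP; split; lra.
by rewrite e cisN cispi; apply: complex_ext; rewrite !reim /=; ring.
Qed.

(* If f2 + f0 leaves [-pi, pi], the point of the second arc whose ratio to the vertices is
   s, with s solving Im (cis f2 * (1 + s * cis f0)) = 0, lies on the first arc. *)
Lemma angle_sum_bound v0 v1 v2 b0 b1 b2 f0 f1 f2 :
  tri v0 v1 v2 b0 b1 b2 f0 f1 f2 ->
  (forall z, onarc v0 v1 b0 z -> onarc v1 v2 b1 z -> z = v1) -> - pi <= f2 + f0 <= pi.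
Proof.
move=> T H; have T' := T; case: T' => v01 v12 v20 _ b1P _ f0P _ f2P [k2 k20 F0] [k0 k00 F1] _.
have s20 : 0 < sqn (v2 - v0) by rewrite sqn_gt0 // subr_eq0.
have c20 : (sqn (v2 - v0))%:C != 0 :> C by rewrite RC_neq0 gt_eqF.
(* If f2 + f0 leaves [-pi, pi], then f2 and f0 have the same sign, and sin (f2 + f0) has the sign
   opposite to both sines. *)
suff NS : ~ (sin f2 * sin (f2 + f0) < 0 /\ sin f0 * sin (f2 + f0) < 0).
  move/andP: f0P => [a1 a2]; move/andP: f2P => [a3 a4].
  rewrite leNgt andbC leNgt; apply/andP; split; apply/negP => h; apply: NS.
    have p2 : 0 < sin f2 by apply: sin_gt0_pi; apply/andP; split; lra.
    have p0 : 0 < sin f0 by apply: sin_gt0_pi; apply/andP; split; lra.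
    have n : 0 < sin (f2 + f0 - pi) by apply: sin_gt0_pi; apply/andP; split; lra.
    rewrite sinB cospi sinpi mulr0 subr0 mulrN1 oppr_gt0 in n.
    by clear -p2 p0 n; split; nra.
  have p2 : 0 < sin (- f2) by apply: sin_gt0_pi; apply/andP; split; lra.
  have p0 : 0 < sin (- f0) by apply: sin_gt0_pi; apply/andP; split; lra.
  have n : 0 < sin (f2 + f0 + 2 * pi) by apply: sin_gt0_pi; apply/andP; split; lra.
  rewrite mulr_natl sinD2pi in n; rewrite !sinN in p2 p0.
  by clear -p2 p0 n; split; nra.
move=> [n1 n2].
set S := sin (f2 + f0) in n1 n2.
have S0 : S != 0 by apply/eqP => S0; rewrite S0 mulr0 ltxx in n1.
set s := - (sin f2 / S).
have sp : 0 < s.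
  have : 0 < s * S ^+ 2.
    by rewrite (_ : s * S ^+ 2 = - (sin f2 * S)) ?oppr_gt0 // /s; field.
  by rewrite pmulr_lgt0 // exprn_even_gt0.
have key : cis f2 + s%:C * cis (f2 + f0) = (sin f0 / S)%:C.
  have sf0 : sin f0 = sin (f2 + f0) * cos f2 - cos (f2 + f0) * sin f2.
    by rewrite -sinB; congr sin; ring.
  apply: complex_ext; rewrite !reim /= mul0r ?subr0 ?addr0 /s -/S; last by field.
  by rewrite sf0 -/S; field.
(* s is rescaled so that F v0 v1 b0 z comes out as a multiple of cis f2 + s * cis (f2 + f0) *)
set m := s * sqn (v2 - v0) / k0.
have m0 : 0 < m by rewrite divr_gt0 ?mulr_gt0.
set D := 1 + m%:C * cis b1.
have D0 : D != 0.
  apply/eqP => D0; have : dirn (cis b1) pi.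
    exists (m^-1); rewrite ?invr_gt0 //.
    rewrite cispi RCV; apply: (mulfI (x := m%:C)); first by rewrite RC_neq0 gt_eqF.
    by rewrite mulrN1 mulrN mulfV ?RC_neq0 ?gt_eqF //; apply/eqP; rewrite -addr_eq0 addrC; apply/eqP.
  move=> d; have := dirn_inj (dirn_cis b1) d; move/andP: b1P => [? ?] e.
  by have : b1 = pi by [apply: e; apply/andP; split; lra]; lra.
(* The solution of v2 - z = - m cis b1 (v1 - z), which puts z on the second edge. *)
set z := (v2 + m%:C * cis b1 * v1) / D.
have q1 : v1 - z = (v1 - v2) / D by rewrite /z /D; field; exact: D0.
have q2 : v2 - z = - (m%:C * cis b1) * ((v1 - v2) / D) by rewrite /z /D; field; exact: D0.
have zv1 : z != v1.
  by rewrite eq_sym -subr_eq0 q1 mulf_neq0 ?invr_eq0 ?subr_eq0.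
have Fz : F v1 v2 b1 z = - (m * sqn (v1 - z))%:C.
  rewrite /F q2 -q1 (RCM m) -mulCJ.
  transitivity (- (m%:C * ((v1 - z) * cj (v1 - z))) * (cis (- b1) * cis b1)); first by ring.
  by rewrite cisNK mulr1.
have s1z : 0 < sqn (v1 - z) by rewrite sqn_gt0 // subr_eq0 eq_sym.
have on1 : onarc v1 v2 b1 z.
  apply/negrayP; exists (m * sqn (v1 - z)); last exact: Fz.
  exact: ltW (mulr_gt0 m0 s1z).
suff on0 : onarc v0 v1 b0 z by move/eqP: zv1; apply; exact: H.
have e : F v0 v1 b0 z = (sqn (v1 - z) / sqn (v1 - v2) * k2 * (sin f0 / S))%:C.
  have me : m * k0 = s * sqn (v2 - v0) by rewrite /m; field; rewrite gt_eqF.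
  rewrite (F_adjacent b0 v12 v20 Fz) F0 F1 [in RHS]RCM -key cisD.
  have -> : m * sqn (v1 - z) / (sqn (v1 - v2) * sqn (v2 - v0)) =
    sqn (v1 - z) / sqn (v1 - v2) * (s / k0).
    by rewrite /m; field; rewrite !gt_eqF // sqn_gt0 // subr_eq0.
  by rewrite !(RCM, RCV); field; rewrite !RC_neq0 !gt_eqF // sqn_gt0 // subr_eq0.
rewrite /onarc e; split => //=.
rewrite pmulr_rle0; last by rewrite mulr_gt0 // divr_gt0 // sqn_gt0 // subr_eq0.
have : sin f0 / S * S ^+ 2 < 0 by rewrite (_ : _ * S ^+ 2 = sin f0 * S) //; field.
by rewrite pmulr_llt0 ?exprn_even_gt0 // => /ltW.
Qed.

(* The angle at v1 on the left of the oriented triangle is pi - f0 - f2. *)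
Lemma tangent_angle v0 v1 v2 b0 b1 b2 f0 f1 f2 :
  tri v0 v1 v2 b0 b1 b2 f0 f1 f2 ->
  exists2 k : R, 0 < k &
    cis b0 * (v0 - v1) = k%:C * (cis (pi - f0 - f2) * (cis (- b1) * (v2 - v1))).
Proof.
case=> v01 v12 v20 _ _ _ _ _ _ [k2 k20 F0] [k0 k00 F1] _.
have s12 : 0 < sqn (v2 - v1) by rewrite sqn_gt0 // subr_eq0 eq_sym.
have s20 : 0 < sqn (v2 - v0) by rewrite sqn_gt0 // subr_eq0.
exists (k2 * k0 / (sqn (v2 - v0) * sqn (v2 - v1))); first by rewrite divr_gt0 ?mulr_gt0.
have -> : pi - f0 - f2 = - f2 + (- f0 + pi) by ring.
rewrite cisD cisDpi -!conj_cis.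
have e : cj (F v0 v1 b0 v2 * F v1 v2 b1 v0) = (k2 * k0)%:C * (cj (cis f2) * cj (cis f0)).
  by rewrite F0 F1 !conjM !conj_real RCM; ring.
rewrite !(RCM, RCV); apply/esym; rewrite RCM in e.
transitivity (- (k2%:C * k0%:C * (cj (cis f2) * cj (cis f0))) * (cj (cis b1) * (v2 - v1)) / ((sqn (v2 - v0))%:C * (sqn (v2 - v1))%:C)).
  by field; rewrite !RC_neq0 !gt_eqF.
rewrite -e /F !conjM !conjK !conj_cis !opprK -!mulCJ.
have c1 : (v2 - v1) != 0 by rewrite subr_eq0 eq_sym.
have c2 : (v2 - v0) != 0 by rewrite subr_eq0.
have c3 : cj (v2 - v1) != 0 by rewrite conj_eq0.
have c4 : cj (v2 - v0) != 0 by rewrite conj_eq0.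
have n1 : cj (v1 - v2) = - cj (v2 - v1) by rewrite -conjN opprB.
have n2 : v0 - v2 = - (v2 - v0) by rewrite opprB.
have n3 : v1 - v0 = - (v0 - v1) by rewrite opprB.
rewrite n1 n2 n3; transitivity (cis b0 * (cis b1 * cis (- b1)) * (v0 - v1)); last by rewrite cisKN mulr1.
rewrite conjD conjN in c3; rewrite conjD conjN in c4.
by field; apply/and4P; split; [exact: c3| exact: c1| exact: c4| exact: c2].
Qed.

End Triangle.

(** * Sectors at a corner *)

Section Sectors.
Variable R : realType.
Local Notation C := R[i].
Local Notation Re := (@complex.Re R).
Local Notation Im := (@complex.Im R).
Local Notation pt := (pt R).
Implicit Types (K X P : C -> Prop) (v d p q z : C).

Definition toC (x : pt) : C := x.1 +i* x.2.
Definition ofC (z : C) : pt := (Re z, Im z).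

Lemma ofCK : cancel ofC toC.
Proof. by case. Qed.
Lemma toCK : cancel toC ofC.
Proof. by case. Qed.

(* X is a union of path components of the complement of K. *)
Definition path_sat K X := forall (g : R -> C) (a b : R),
  continuous (fun t => Re (g t)) -> continuous (fun t => Im (g t)) -> a <= b ->
  (forall t, a <= t <= b -> ~ K (g t)) -> X (g a) <-> X (g b).

(** The image of the path is connected and avoids S, so both ends lie in the same component of the
    complement. *)
Lemma interior_path_sat (S : set pt) :
  path_sat (fun z => S (ofC z)) (fun z => interior_of S (ofC z)).
Proof.
move=> g a b cr ci ab av.
pose f t : pt := ofC (g t).
have cf : continuous f.
  by move=> t; rewrite /f /ofC; apply: (@cvg_pair _ _ _ _ _ _ _ _ _ _ _ (cr t) (ci t)).
have conn : connected (f @` `[a, b]).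
  apply: connected_continuous_connected; first exact: segment_connected.
  exact: continuous_subspaceT.
have sub : f @` `[a, b] `<=` ~` S.
  by move=> x [t /=]; rewrite in_itv /= => ht <-; exact: av.
have ma : (f @` `[a, b]) (f a) by exists a => //=; rewrite in_itv /= lexx ab.
have mb : (f @` `[a, b]) (f b) by exists b => //=; rewrite in_itv /= lexx ab.
have e : connected_component (~` S) (f a) = connected_component (~` S) (f b).
  apply: same_connected_component.
  exact: (connected_component_max ma sub conn) _ mb.
rewrite /interior_of /= -/(f a) -/(f b) e.
have na : ~ S (f a) by exact: sub _ ma.
have nb : ~ S (f b) by exact: sub _ mb.
by split => -[].
Qed.

Lemma path_sat_compl K X : path_sat K X -> path_sat K (fun z => ~ X z).
Proof. by move=> h g a b cr ci ab av; have [h1 h2] := h g a b cr ci ab av; split; tauto. Qed.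

(** One radius e serves all directions of the closed range, so that turning around v within it stays
    in P. A single ray is the case a1 = a2. *)
Definition sec P v d (a1 a2 : R) := exists2 e : R, 0 < e &
  forall r a, 0 < r < e -> a1 <= a <= a2 -> P (v + r%:C * (cis a * d)).

Lemma sec_sub P v d a1 a2 a3 a4 : a1 <= a3 -> a4 <= a2 -> sec P v d a1 a2 -> sec P v d a3 a4.
Proof.
move=> h1 h2 [e e0 h]; exists e => // r a hr /andP[? ?]; apply: h => //.
by apply/andP; split; lra.
Qed.

Lemma sec_and P Q v d a1 a2 : sec P v d a1 a2 -> sec Q v d a1 a2 ->
  sec (fun z => P z /\ Q z) v d a1 a2.
Proof.
move=> [e e0 h] [e' e0' h']; exists (Num.min e e'); first by rewrite lt_min e0.
by move=> r a; rewrite lt_min => /and3P[r0 r1 r2] ha; split; [apply: h|apply: h'] => //; rewrite r0.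
Qed.

Lemma sec_imp (P Q : C -> Prop) v d a1 a2 : (forall z, P z -> Q z) -> sec P v d a1 a2 -> sec Q v d a1 a2.
Proof. by move=> PQ [e e0 h]; exists e => // r a hr ha; apply: PQ; apply: h. Qed.

Lemma sec_frame P v d d' k c a1 a2 : 0 < k -> d = k%:C * (cis c * d') ->
  sec P v d' (a1 + c) (a2 + c) -> sec P v d a1 a2.
Proof.
move=> k0 -> [e e0 h]; exists (e / k); first by rewrite divr_gt0.
move=> r a /andP[r0 r1] /andP[h1 h2].
have := h (r * k) (a + c); rewrite RCM cisD => H.
have -> : r%:C * (cis a * (k%:C * (cis c * d'))) = r%:C * k%:C * (cis a * cis c * d') by ring.
apply: H; first by rewrite mulr_gt0 //= -ltr_pdivlMr.
by apply/andP; split; lra.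
Qed.

Lemma sec_shift P v d a1 a2 : sec P v d (a1 + 2 * pi) (a2 + 2 * pi) -> sec P v d a1 a2.
Proof.
apply: (@sec_frame P v d d 1 (2 * pi)) => //.
by rewrite cis2pi !mul1r.
Qed.

(** Two points of a truncated sector free of K are joined by a radial segment followed by a circular
    arc about v. *)
Lemma sector_link K X v d a1 a2 : path_sat K X -> sec (fun z => ~ K z) v d a1 a2 ->
  exists2 e : R, 0 < e & forall r r' a a', 0 < r < e -> 0 < r' < e ->
    a1 <= a <= a2 -> a1 <= a' <= a2 ->
    X (v + r%:C * (cis a * d)) <-> X (v + r'%:C * (cis a' * d)).
Proof.
move=> sX [e e0 av]; exists e => //.
have lin (c1 c2 : R) : continuous (fun t : R => c1 + t * c2).
  by move=> t; apply: cvgD; [exact: cvg_cst|exact: cvgMl].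
have rad r r' a : r <= r' -> 0 < r < e -> 0 < r' < e -> a1 <= a <= a2 ->
    X (v + r%:C * (cis a * d)) <-> X (v + r'%:C * (cis a * d)).
  move=> rr /andP[r0 r1] /andP[r0' r1'] ha.
  apply: (sX (fun t => v + t%:C * (cis a * d)) r r') => //.
  - rewrite (_ : (fun t => _) = (fun t => Re v + t * Re (cis a * d))); first exact: lin.
    by apply/funext => t; rewrite !reim /=; ring.
  - rewrite (_ : (fun t => _) = (fun t => Im v + t * Im (cis a * d))); first exact: lin.
    by apply/funext => t; rewrite !reim /=; ring.
  - move=> t /andP[? ?]; apply: av => //; apply/andP; split; lra.
have ang r a a' : a <= a' -> 0 < r < e -> a1 <= a <= a2 -> a1 <= a' <= a2 ->
    X (v + r%:C * (cis a * d)) <-> X (v + r%:C * (cis a' * d)).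
  move=> aa hr /andP[h1 h2] /andP[h3 h4].
  apply: (sX (fun t => v + r%:C * (cis t * d)) a a') => //.
  - rewrite (_ : (fun t => _) = (fun t => Re v + (cos t * (r * Re d) - sin t * (r * Im d)))).
      move=> t; apply: cvgD; first exact: cvg_cst.
      by apply: cvgB; apply: cvgMl; [exact: continuous_cos|exact: continuous_sin].
    by apply/funext => t; rewrite !reim /=; ring.
  - rewrite (_ : (fun t => _) = (fun t => Im v + (cos t * (r * Im d) + sin t * (r * Re d)))).
      move=> t; apply: cvgD; first exact: cvg_cst.
      by apply: cvgD; apply: cvgMl; [exact: continuous_cos|exact: continuous_sin].
    by apply/funext => t; rewrite !reim /=; ring.
  - move=> t /andP[? ?]; apply: av => //; apply/andP; split; lra.
move=> r r' a a' hr hr' ha ha'.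
apply: (@iff_trans _ (X (v + r'%:C * (cis a * d)))).
  by case/orP: (le_total r r') => h; [exact: rad|apply: iff_sym; exact: rad].
by case/orP: (le_total a a') => h; [exact: ang|apply: iff_sym; exact: ang].
Qed.

Lemma sector_extend K X v d a1 a2 : path_sat K X -> sec (fun z => ~ K z) v d a1 a2 ->
  (forall e, 0 < e -> exists r a, [/\ 0 < r < e, a1 <= a <= a2 & X (v + r%:C * (cis a * d))]) ->
  sec X v d a1 a2.
Proof.
move=> sX av h; have [e e0 l] := sector_link sX av.
have [r [a [hr ha x]]] := h e e0.
by exists e => // r' a' hr' ha'; apply/(l r r' a a').
Qed.

Lemma sec_disj X v d a : sec X v d a a -> sec (fun z => ~ X z) v d a a -> False.
Proof.
move=> h h'; have [e e0 H] := sec_and h h'.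
have [] := H (e / 2) a; rewrite ?lexx //.
by apply/andP; split; lra.
Qed.

Lemma cos_le_ends (a1 a2 a : R) : 0 < a1 -> a1 <= a <= a2 -> a2 < 2 * pi ->
  cos a <= Num.max (cos a1) (cos a2).
Proof.
move=> h0 /andP[h1 h2] h3; rewrite le_max; apply/orP.
have mono (x y : R) : 0 <= x -> x <= y -> y <= pi -> cos y <= cos x.
  move=> x0 xy yp; rewrite leNgt; apply/negP => h.
  have : y < x by rewrite -ltr_cos // in_itv /=; apply/andP; split; lra.
  lra.
have refl (x : R) : cos x = cos (2 * pi - x).
  by rewrite cosB mulr_natl cos2pi sin2pi; ring.
case: (leP a pi) => hp; [left; apply: mono; lra|right].
rewrite (refl a) (refl a2); apply: mono; lra.
Qed.

Lemma cos_lt1 (a : R) : 0 < a < 2 * pi -> cos a < 1.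
Proof.
move=> /andP[h1 h2]; rewrite lt_neqAle cos_le1 andbT; apply/eqP => c1.
have s0 : sin a = 0 by have := cos2Dsin2 a; rewrite c1 => h; apply/eqP; rewrite -sqrf_eq0; apply/eqP; lra.
have : a = 0 by apply: cis_eq1; [apply/andP; split; lra|rewrite /cis c1 s0].
lra.
Qed.

(** A point of the arc in direction a, at distance r in units of the chord, satisfies sin a = r sin
    b and cos a = y + r cos b with y >= 0. For small r this forces cos a close to 1, whereas the
    sector keeps it at most m < 1. Taking m >= 0 keeps the radius (1 - m) / 2 at most 1 / 2, which
    excludes cos a < 0. *)
Lemma onarc_sector_start p q b a1 a2 : p != q -> 0 < a1 -> a1 <= a2 -> a2 < 2 * pi ->
  sec (fun z => ~ onarc p q b z) p (out p q b) a1 a2.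
Proof.
move=> pq h1 h12 h2.
set m := Num.max (Num.max (cos a1) (cos a2)) 0.
have m1 : m < 1 by rewrite !gt_max ltr01 !cos_lt1 //; apply/andP; split; lra.
have m0 : 0 <= m by rewrite le_max lexx orbT.
exists ((1 - m) / 2); first by lra.
move=> r a /andP[r0 r1] ha /negrayP[x x0]; rewrite F_start => e.
have sd : 0 < sqn (out p q b).
  by rewrite sqn_gt0 // mulf_neq0 ?cis_neq0 // subr_eq0 eq_sym.
move: sd e; move: (sqn (out p q b)) => n n0 e.
have e2 : cis (- a) = (x / (r * n))%:C + r%:C * cis (- b) :> C.
  have rn : (r * n)%:C != 0 :> C by rewrite RC_neq0 gt_eqF // mulr_gt0.
  apply/eqP; rewrite -subr_eq; apply/eqP; apply: (mulfI rn).
  rewrite (RCM x) RCV mulrCA mulfV // mulr1.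
  by apply: oppr_inj; rewrite -e; ring.
have [re im] : cos a = x / (r * n) + r * cos b /\ sin a = r * sin b.
  have := congr1 Re e2; have := congr1 Im e2; rewrite !reim /= !cosN !sinN => h3 h4.
  by split; lra.
have y0 : 0 <= x / (r * n) by rewrite divr_ge0 // ltW // mulr_gt0.
have cm : cos a <= m by rewrite le_max cos_le_ends.
have := cos2Dsin2 a; have := cos2Dsin2 b; have := cos_geN1 b.
rewrite im; set cb := cos b in re *; set sb := sin b; set ca := cos a in re cm *.
move=> c1 c2 c3; set y := x / _ in re y0.
have c4 : - r <= ca by nra.
have c5 : ca ^+ 2 >= 1 - r ^+ 2 by nra.
case: (leP 0 ca) => hc; nra.
Qed.

Lemma onarc_sector_end p q b a1 a2 : p != q -> 0 < a1 -> a1 <= a2 -> a2 < 2 * pi ->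
  sec (fun z => ~ onarc p q b z) q (cis b * (p - q)) a1 a2.
Proof.
move=> pq h1 h12 h2; rewrite -{2}[b]opprK eq_sym in pq *.
by apply: sec_imp (onarc_sector_start (- b) pq h1 h12 h2) => z; rewrite onarc_rev.
Qed.

(** * Continuity of F, and directions at a point off an edge *)

Lemma continuous_ReF p q b : continuous (fun x : pt => Re (F p q b (toC x))).
Proof.
rewrite (_ : (fun x => _) = (fun x : pt =>
   cos b * ((Re q - x.1) * (Re p - x.1) + (Im q - x.2) * (Im p - x.2)) +
   sin b * ((Im q - x.2) * (Re p - x.1) - (Re q - x.1) * (Im p - x.2)))); last first.
  by apply/funext => x; rewrite /F !reim /= cosN sinN; ring.
move=> x; have c1 : (fun x : pt => x.1) @ x --> x.1 by exact: cvg_fst.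
have c2 : (fun x : pt => x.2) @ x --> x.2 by exact: cvg_snd.
have k (c : R) : (fun _ : pt => c) @ x --> c by exact: cvg_cst.
apply: cvgD; apply: cvgM => //; [apply: cvgD|apply: cvgB]; apply: cvgM; exact: cvgB.
Qed.

Lemma continuous_ImF p q b : continuous (fun x : pt => Im (F p q b (toC x))).
Proof.
rewrite (_ : (fun x => _) = (fun x : pt =>
   cos b * ((Im q - x.2) * (Re p - x.1) - (Re q - x.1) * (Im p - x.2)) -
   sin b * ((Re q - x.1) * (Re p - x.1) + (Im q - x.2) * (Im p - x.2)))); last first.
  by apply/funext => x; rewrite /F !reim /= cosN sinN; ring.
move=> x; have c1 : (fun x : pt => x.1) @ x --> x.1 by exact: cvg_fst.
have c2 : (fun x : pt => x.2) @ x --> x.2 by exact: cvg_snd.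
have k (c : R) : (fun _ : pt => c) @ x --> c by exact: cvg_cst.
apply: cvgB; apply: cvgM => //; [apply: cvgB|apply: cvgD]; apply: cvgM; exact: cvgB.
Qed.

Lemma open_not_negray (T : topologicalType) (g : T -> C) :
  continuous (fun x => Re (g x)) -> continuous (fun x => Im (g x)) ->
  open [set x | ~ negray (g x)].
Proof.
move=> cr ci.
rewrite (_ : mkset _ = (fun x => Im (g x)) @^-1` [set y | y != 0] `|` (fun x => Re (g x)) @^-1` [set y | 0 < y]).
  by apply: openU; apply: open_comp => //.
apply/seteqP; split => x /=; rewrite /negray.
  by move=> h; have [i0|i0] := eqVneq (Im (g x)) 0; [right|left]; rewrite ?ltNge //; apply/negP => r0; apply: h.
by case=> h [i0 r0]; [rewrite i0 eqxx in h|rewrite ltNge r0 in h].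
Qed.

Lemma onarc_sector_far p q b v d a1 a2 : ~ onarc p q b v ->
  sec (fun z => ~ onarc p q b z) v d a1 a2.
Proof.
move=> nv; have o := open_not_negray (@continuous_ReF p q b) (@continuous_ImF p q b).
have : nbhs (ofC v) [set x : pt | ~ negray (F p q b (toC x))].
  by apply: open_nbhs_nbhs; split => //=; rewrite ofCK.
move=> /nbhs_ballP[e /= e0 he].
set M := 1 + (`|Re d| + `|Im d|).
have M0 : 0 < M by rewrite ltr_wpDr ?addr_ge0.
exists (e / M); first by rewrite divr_gt0.
move=> r a /andP[r0 r1] _; rewrite ltr_pdivlMr // in r1.
rewrite -[v + _]ofCK; apply: he.
have bd (x y : R) : `|x| <= 1 -> `|y| <= 1 -> `|r * (x * Re d + y * Im d)| < e.
  move=> x1 y1; apply: le_lt_trans r1; rewrite normrM gtr0_norm // ler_pM2l //.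
  apply: le_trans (ler_normD _ _) _; rewrite !normrM /M.
  have := normr_ge0 (Re d); have := normr_ge0 (Im d); nra.
split; rewrite /ball /= !reim /= distrC addrC addKr !mul0r ?subr0 ?addr0.
  by have := bd (cos a) (- sin a) (cos_max a); rewrite normrN => /(_ (sin_max a)); rewrite mulNr.
by have := bd (sin a) (cos a) (sin_max a) (cos_max a); rewrite addrC.
Qed.

End Sectors.

(** * Following an edge *)

Section Transfer.
Variable R : realType.
Local Notation C := R[i].
Local Notation Re := (@complex.Re R).
Local Notation Im := (@complex.Im R).
Implicit Types (K X P : C -> Prop) (v d p q z : C).

Definition crv v0 v1 v2 (b0 b1 b2 : R) z :=
  [\/ onarc v0 v1 b0 z, onarc v1 v2 b1 z | onarc v2 v0 b2 z].

Lemma crv_rot v0 v1 v2 b0 b1 b2 z : crv v1 v2 v0 b1 b2 b0 z <-> crv v0 v1 v2 b0 b1 b2 z.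
Proof.
by split=> -[h|h|h]; [apply: Or32|apply: Or33|apply: Or31|apply: Or33|apply: Or31|apply: Or32].
Qed.

Lemma crv_rot2 v0 v1 v2 b0 b1 b2 z : crv v2 v0 v1 b2 b0 b1 z <-> crv v0 v1 v2 b0 b1 b2 z.
Proof. by rewrite (crv_rot v1) (crv_rot v0). Qed.

Lemma path_sat_rot X v0 v1 v2 b0 b1 b2 :
  path_sat (crv v0 v1 v2 b0 b1 b2) X -> path_sat (crv v1 v2 v0 b1 b2 b0) X.
Proof.
move=> sX g a b cr ci ab av; apply: sX => // t ht.
by rewrite -crv_rot; apply: av.
Qed.

(** Angles at v1 are counted from the edge leaving v1. The arriving edge lies at L = pi - f0 - f2 by
    [tangent_angle], and the opposite edge misses v1, so only 0, L and 2 pi have to be avoided. *)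
Lemma vertex_sector v0 v1 v2 b0 b1 b2 f0 f1 f2 (a1 a2 : R) :
  tri v0 v1 v2 b0 b1 b2 f0 f1 f2 -> 0 <= pi - f0 - f2 <= 2 * pi ->
  0 < a1 -> a1 <= a2 -> a2 < 2 * pi -> a2 < pi - f0 - f2 \/ pi - f0 - f2 < a1 ->
  sec (fun z => ~ crv v0 v1 v2 b0 b1 b2 z) v1 (out v1 v2 b1) a1 a2.
Proof.
move=> T /andP[L1 L2] h1 h12 h2 hL.
have s1 : sec (fun z => ~ onarc v1 v2 b1 z) v1 (out v1 v2 b1) a1 a2.
  by apply: onarc_sector_start => //; exact: tri_v12 T.
have s2 : sec (fun z => ~ onarc v2 v0 b2 z) v1 (out v1 v2 b1) a1 a2.
  by apply: onarc_sector_far; exact: dirn_not_negray (tri_f1 T) (tri_F2 T).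
have s0 : sec (fun z => ~ onarc v0 v1 b0 z) v1 (out v1 v2 b1) a1 a2.
  have [k k0 e] := tangent_angle T.
  set L := pi - f0 - f2 in e hL L1 L2.
  have k'0 : 0 < k^-1 by rewrite invr_gt0.
  apply: (@sec_frame _ _ _ _ (cis b0 * (v0 - v1)) k^-1 (- L)) => //.
    rewrite e /out RCV.
    transitivity ((cis (- L) * cis L) * (cis (- b1) * (v2 - v1)) * ((k%:C)^-1 * k%:C)); last by ring.
    by rewrite cisNK mulVf ?RC_neq0 ?gt_eqF // mul1r mulr1.
  case: hL => hL; last by apply: onarc_sector_end; [exact: tri_v01 T|lra|lra|lra].
  (* Below L the angles a - L are negative; a full turn brings them into ]0, 2 pi[. *)
  by apply: sec_shift; apply: onarc_sector_end; [exact: tri_v01 T|lra|lra|lra].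
apply: sec_imp (sec_and s0 (sec_and s1 s2)) => z [n0 [n1 n2]].
by case.
Qed.

Lemma vertex_same v0 v1 v2 b0 b1 b2 f0 f1 f2 X (a a' : R) :
  tri v0 v1 v2 b0 b1 b2 f0 f1 f2 -> 0 <= pi - f0 - f2 <= 2 * pi ->
  path_sat (crv v0 v1 v2 b0 b1 b2) X ->
  0 < a < 2 * pi -> 0 < a' < 2 * pi ->
  (a < pi - f0 - f2 /\ a' < pi - f0 - f2) \/ (pi - f0 - f2 < a /\ pi - f0 - f2 < a') ->
  sec X v1 (out v1 v2 b1) a a -> sec X v1 (out v1 v2 b1) a' a'.
Proof.
move=> T hL sX /andP[h1 h2] /andP[h3 h4] h [e e0 xa].
have av : sec (fun z => ~ crv v0 v1 v2 b0 b1 b2 z) v1 (out v1 v2 b1) (Num.min a a') (Num.max a a').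
  apply: (vertex_sector T hL).
  - by rewrite lt_min h1.
  - by rewrite le_max ge_min lexx.
  - by rewrite gt_max h2.
  - by case: h => -[h h']; [left; rewrite gt_max h|right; rewrite lt_min h].
apply: (@sec_sub _ _ _ _ (Num.min a a') (Num.max a a')).
- by rewrite ge_min lexx orbT.
- by rewrite le_max lexx orbT.
apply: (sector_extend sX av) => e' e'0.
exists (Num.min e e' / 2), a; have m0 : 0 < Num.min e e' by rewrite lt_min e0.
have m1 : Num.min e e' <= e by rewrite ge_min lexx.
have m2 : Num.min e e' <= e' by rewrite ge_min lexx orbT.
split; first by apply/andP; split; lra.
  by rewrite ge_min le_max lexx.
by apply: xa; rewrite ?lexx //; apply/andP; split; lra.
Qed.

Lemma continuous_chord (b : R) : continuous (chord b).
Proof.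
have cs : continuous (fun t : R => sin (t * b)).
  move=> t; apply: (@continuous_comp R R R (fun y => y * b) sin); last exact: continuous_sin.
  exact: cvgMl.
have c : continuous (fun t : R => sin (t * b) / sin b).
  by move=> t; apply: cvgMl; exact: cs.
have [b0|b0] := boolP (b == 0).
  have -> : chord b = id by apply/funext => t; rewrite /chord b0.
  by move=> t; exact: cvg_id.
by have -> : chord b = fun t => sin (t * b) / sin b by apply/funext => t; rewrite /chord (negbTE b0).
Qed.

(** Provides points of an arc close to an end and in a direction close to its tangent there. The
    bound 1 / 2 keeps the points chosen at the two ends in order. *)
Lemma chord_small (b e : R) : 0 < e ->
  exists2 t : R, 0 < t < 1 / 2 & chord b t < e /\ `|t * b| < e.
Proof.
move=> e0.
have c1 : chord b @ (0 : R) --> (0 : R) by rewrite -{2}(chord0 b); exact: continuous_chord.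
have H : \forall t \near nbhs (0 : R), `|chord b t| < e by exact: cvgr0_norm_lt c1 _ e0.
 have [r /= r0 h] := (nbhs_ballP (0 : R) _).1 H.
set t := Num.min (Num.min (r / 2) (e / (1 + `|b|) / 2)) (1 / 4).
have b1 : 0 < 1 + `|b| by rewrite ltr_wpDr.
have eb : 0 < e / (1 + `|b|) by rewrite divr_gt0.
have t0 : 0 < t by rewrite !lt_min; apply/andP; split; [apply/andP; split|]; lra.
have t1 : t <= r / 2 by rewrite !ge_min lexx.
have t2 : t <= e / (1 + `|b|) / 2 by rewrite !ge_min lexx orbT.
have t3 : t <= 1 / 4 by rewrite !ge_min lexx orbT.
exists t; first by apply/andP; split; lra.
split.
  apply: le_lt_trans (ler_norm _) _; apply: h.
  by rewrite /ball /= sub0r normrN gtr0_norm //; lra.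
rewrite normrM gtr0_norm //.
have : t * (1 + `|b|) < e by rewrite -ltr_pdivlMr //; lra.
by apply: le_lt_trans; rewrite ler_pM2l // lerDr.
Qed.

Lemma continuous_apt p q (b : R) :
  continuous (fun t => Re (apt p q b t)) /\ continuous (fun t => Im (apt p q b t)).
Proof.
have cc := @continuous_chord b.
have ca : continuous (fun t : R => - ((1 - t) * b)).
  by move=> t; apply: cvgN; apply: cvgMl; apply: cvgB => //; exact: cvg_cst.
have c1 : continuous (fun t : R => cos (- ((1 - t) * b))).
  by move=> t; apply: (@continuous_comp R R R (fun t => - ((1 - t) * b)) cos); [exact: ca|exact: continuous_cos].
have c2 : continuous (fun t : R => sin (- ((1 - t) * b))).
  by move=> t; apply: (@continuous_comp R R R (fun t => - ((1 - t) * b)) sin); [exact: ca|exact: continuous_sin].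
split.
  rewrite (_ : (fun t => _) = (fun t => Re p + chord b t * (cos (- ((1 - t) * b)) * Re (q - p) - sin (- ((1 - t) * b)) * Im (q - p)))).
    move=> t; apply: cvgD; first exact: cvg_cst.
    apply: cvgM; first exact: cc.
    by apply: cvgB; apply: cvgMl; [exact: c1|exact: c2].
  by apply/funext => t; rewrite /apt !reim /=; ring.
rewrite (_ : (fun t => _) = (fun t => Im p + chord b t * (cos (- ((1 - t) * b)) * Im (q - p) + sin (- ((1 - t) * b)) * Re (q - p)))).
  move=> t; apply: cvgD; first exact: cvg_cst.
  apply: cvgM; first exact: cc.
  by apply: cvgD; apply: cvgMl; [exact: c1|exact: c2].
by apply/funext => t; rewrite /apt !reim /=; ring.
Qed.

(* The arc from v0 to v1 making angle dl with the first edge avoids the triangle, so it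
   carries membership in a union of components of the complement from v0 to v1. *)
Lemma transfer v0 v1 v2 b0 b1 b2 f0 f1 f2 X (dl al be et : R) :
  tri v0 v1 v2 b0 b1 b2 f0 f1 f2 -> path_sat (crv v0 v1 v2 b0 b1 b2) X ->
  dl != 0 -> - pi < b0 + dl < pi -> - (2 * pi) < dl < 2 * pi ->
  off_range f2 f0 (dl - pi) -> off_range f2 f1 (dl - pi) ->
  0 < et -> cis al = cis (- dl) -> cis be = cis (pi - f0 - f2 + dl) ->
  sec (fun z => ~ crv v0 v1 v2 b0 b1 b2 z) v0 (out v0 v1 b0) (al - et) (al + et) ->
  sec (fun z => ~ crv v0 v1 v2 b0 b1 b2 z) v1 (out v1 v2 b1) (be - et) (be + et) ->
  sec X v0 (out v0 v1 b0) al al -> sec X v1 (out v1 v2 b1) be be.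
Proof.
move=> T sX dl0 hb hdl o0 o1 et0 eal ebe av0 av1 x0.
have v01 := tri_v01 T.
set b' := b0 + dl in hb.
have free t : 0 < t < 1 -> ~ crv v0 v1 v2 b0 b1 b2 (apt v0 v1 b' t).
  move=> /andP[t0 t1].
  have t01 : 0 <= t <= 1 by rewrite !ltW.
  have zv1 : apt v0 v1 b' t <> v1 by apply/eqP/apt_neq_end => //; rewrite ltW.
  have zv0 : apt v0 v1 b' t <> v0 by apply/eqP/apt_neq_start => //; rewrite t0 ltW.
  have [x x00 e] := (negrayP _).1 (apt_onarc v0 v1 hb t01).
  have x_0 : 0 < x.
    rewrite lt_neqAle x00 andbT eq_sym; apply/eqP => x_0; move/eqP: e.
    rewrite x_0 oppr0 /F !mulf_eq0 (negbTE (cis_neq0 _)) conj_eq0 !subr_eq0 /=.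
    by case/orP => /eqP h; [apply: zv1|apply: zv0].
  (* Adding dl to the bulge multiplies F by cis (- dl). Along the new arc, F of the first edge thus
     has the constant direction dl - pi, which the two [off_range] hypotheses exclude on the other
     edges. *)
  have eF : F v0 v1 b0 (apt v0 v1 b' t) = x%:C * cis (dl - pi).
    have -> : F v0 v1 b0 (apt v0 v1 b' t) = cis dl * F v0 v1 b' (apt v0 v1 b' t).
      rewrite /F /b' (opprD b0) (cisD (- b0)).
      transitivity (cis (- b0) * (cis dl * cis (- dl)) * (v1 - apt v0 v1 b' t) * cj (v0 - apt v0 v1 b' t)); last by rewrite /b'; ring.
      by rewrite cisKN mulr1.
    rewrite e; have -> : cis dl = - cis (dl - pi) by rewrite -cisDpi subrK.
    by ring.
  case=> [on|on|on].
  - have [y y0 e'] := (negrayP _).1 on.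
    have d1 : dirn (cis dl) 0.
      exists (y / x).
        rewrite divr_gt0 // lt_neqAle y0 andbT eq_sym; apply/eqP => y_0; move/eqP: e'.
        by rewrite eF y_0 oppr0 mulf_eq0 (negbTE (cis_neq0 _)) orbF -[_ == _]negbK RC_neq0 gt_eqF.
      have xn : x%:C != 0 :> C by rewrite RC_neq0 gt_eqF.
      apply: (mulfI xn); have -> : cis dl = - cis (dl - pi) by rewrite -cisDpi subrK.
      rewrite mulrN -eF e' opprK cis0 mulr1 RCM RCV; field; exact: xn.
    have : dl = 0 by apply: (dirn_inj (dirn_cis dl) d1); rewrite subr0.
    by apply/eqP.
  - exact: zv1 (F_adjacent_off T o0 x00 eF on).
  - exact: zv0 (F_other_adjacent_off T o1 x00 eF on).
have [e0 e00 l0] := sector_link sX av0.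
have [k k0 tg] := tangent_angle T.
have [e1 e10 l1] := sector_link sX av1.
pose m0 := Num.min e0 et; pose m1 := Num.min (e1 / k) et.
have [t0 /andP[t00 t01] [c0 n0]] : exists2 t : R, 0 < t < 1 / 2 & chord b' t < m0 /\ `|t * b'| < m0.
  by apply: chord_small; rewrite lt_min e00.
have [t1 /andP[t10 t11] [c1 n1]] : exists2 t : R, 0 < t < 1 / 2 & chord b' t < m1 /\ `|t * b'| < m1.
  by apply: chord_small; rewrite lt_min et0 divr_gt0.
move: c0 n0 c1 n1; rewrite !lt_min => /andP[c0 _] /andP[_ n0] /andP[c1 _] /andP[_ n1].
rewrite !ltr_norml in n0 n1.
rewrite ltr_pdivlMr // in c1.
have p0 : 0 < chord b' t0 by apply: chord_gt0 => //; clear -t00 t01; apply/andP; split; lra.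
have p1 : 0 < chord b' t1 by apply: chord_gt0 => //; clear -t10 t11; apply/andP; split; lra.
(* Near its ends the arc has directions al + t0 b' and be - t1 b' in the frames of v0 and v1, within
   et of al and be, so both points lie in the free sectors. *)
have E0 : apt v0 v1 b' t0 = v0 + (chord b' t0)%:C * (cis (al + t0 * b') * out v0 v1 b0).
  by rewrite aptE_start /out /b' (opprD b0) (cisD al) (cisD (- b0)) eal; ring.
have E1 : apt v0 v1 b' (1 - t1) = v1 + (chord b' t1 * k)%:C * (cis (be - t1 * b') * out v1 v2 b1).
  rewrite aptE_end // (_ : 1 - (1 - t1) = t1); last by ring.
  have -> : cis b' * (v0 - v1) = cis dl * (cis b0 * (v0 - v1)) by rewrite /b' cisD; ring.
  by rewrite tg (cisD be) ebe (cisD _ dl) RCM /out; ring.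
have X0 : X (apt v0 v1 b' t0).
  have [e e_0 xe] := x0; pose r := Num.min e e0 / 2.
  have rp : 0 < Num.min e e0 by rewrite lt_min e_0.
  have r1 : Num.min e e0 <= e by rewrite ge_min lexx.
  have r2 : Num.min e e0 <= e0 by rewrite ge_min lexx orbT.
  have xr : X (v0 + r%:C * (cis al * out v0 v1 b0)).
    by apply: xe; rewrite ?lexx // /r; clear -rp r1; apply/andP; split; lra.
  rewrite E0; apply/(l0 r _ al) => //.
  - by rewrite /r; clear -rp r2; apply/andP; split; lra.
  - by rewrite p0.
  - by clear -et0; apply/andP; split; lra.
  - by move/andP: n0 => [n2 n3]; clear -n2 n3; apply/andP; split; lra.
have X1 : X (apt v0 v1 b' (1 - t1)).
  have [cr ci] := continuous_apt v0 v1 b'.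
  apply/(sX (apt v0 v1 b') t0 (1 - t1) cr ci) => //; first by clear -t01 t11; lra.
  by move=> t /andP[u0 u1]; apply: free; clear -t00 t10 u0 u1; apply/andP; split; lra.
rewrite E1 in X1; exists e1 => // r a hr /andP[h1 h2].
have -> : a = be by clear -h1 h2; lra.
apply/(l1 (chord b' t1 * k) r (be - t1 * b') be) => //.
- by rewrite c1 mulr_gt0.
- by move/andP: n1 => [n2 n3]; clear -n2 n3; apply/andP; split; lra.
- by clear -et0; apply/andP; split; lra.
Qed.

(** The first edge is turned clockwise at v0 by M / 2, into the right sides of both corners, whose
    angles 2 pi - L0 and 2 pi - L1 are positive. [vertex_same] passes between a or a' and the
    direction of the turned edge. *)
Lemma right_transfer v0 v1 v2 b0 b1 b2 f0 f1 f2 X (a a' : R) :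
  tri v0 v1 v2 b0 b1 b2 f0 f1 f2 -> path_sat (crv v0 v1 v2 b0 b1 b2) X ->
  0 <= pi - f1 - f2 < a -> 0 <= pi - f0 - f2 < a' -> a < 2 * pi -> a' < 2 * pi ->
  sec X v0 (out v0 v1 b0) a a -> sec X v1 (out v1 v2 b1) a' a'.
Proof.
move=> T sX /andP[hL0 ha] /andP[hL1 ha'] a2 a2' x0.
have /andP[g1 g2] := tri_f2 T; have /andP[g3 g4] := tri_b0 T.
have T' := tri_rot (tri_rot T).
have sX' := path_sat_rot (path_sat_rot sX).
have pp := pi_gt0 R.
set L0 := pi - f1 - f2 in hL0 ha; set L1 := pi - f0 - f2 in hL1 ha'.
(* The four bounds keep the turned edge within the two right sides, its bulge b0 + M / 2 below pi,
   and the direction M / 2 - pi below f2. *)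
pose M := Num.min (Num.min (2 * pi - L0) (2 * pi - L1)) (Num.min (pi - b0) (pi + f2)).
have M0 : 0 < M by clear -ha ha' a2 a2' g1 g4; rewrite !lt_min; apply/andP; split; apply/andP; split; lra.
have [M1 M2 M3 M4] : [/\ M <= 2 * pi - L0, M <= 2 * pi - L1, M <= pi - b0 & M <= pi + f2].
  by split; rewrite !ge_min lexx ?orbT.
have eL0 : pi - f2 - f1 = L0 by rewrite /L0; ring.
have s0 c1 c2 : L0 < c1 -> c1 <= c2 -> c2 < 2 * pi ->
    sec (fun z => ~ crv v0 v1 v2 b0 b1 b2 z) v0 (out v0 v1 b0) c1 c2.
  move=> h1 h2 h3; apply: sec_imp (vertex_sector (a1 := c1) (a2 := c2) T' _ _ _ _ _).
  + by move=> z; rewrite crv_rot2.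
  + by rewrite eL0; clear -hL0 ha a2; apply/andP; split; lra.
  + by clear -hL0 h1; lra.
  + by [].
  + by [].
  + by right; rewrite eL0.
have s1 c1 c2 : L1 < c1 -> c1 <= c2 -> c2 < 2 * pi ->
    sec (fun z => ~ crv v0 v1 v2 b0 b1 b2 z) v1 (out v1 v2 b1) c1 c2.
  move=> h1 h2 h3; apply: (vertex_sector T) => //.
  + by rewrite -/L1; clear -hL1 ha' a2'; apply/andP; split; lra.
  + by clear -hL1 h1; lra.
  + by right.
have x0' : sec X v0 (out v0 v1 b0) (2 * pi - M / 2) (2 * pi - M / 2).
  apply: (vertex_same (a := a) T' _ sX') => //.
  + by rewrite eL0; clear -hL0 ha a2; apply/andP; split; lra.
  + by clear -hL0 ha a2; apply/andP; split; lra.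
  + by clear -hL0 M0 M1; apply/andP; split; lra.
  + by right; rewrite eL0; clear -ha M0 M1; split; lra.
have x1 : sec X v1 (out v1 v2 b1) (L1 + M / 2) (L1 + M / 2).
  apply: (transfer (dl := M / 2) (al := 2 * pi - M / 2) (et := M / 4) T sX) => //.
  + by rewrite gt_eqF //; clear -M0; lra.
  + by clear -g3 M0 M3; apply/andP; split; lra.
  + by clear -hL0 M0 M1; apply/andP; split; lra.
  + by clear -g1 g2 M0 M2 M4 hL1; rewrite /L1 in M2 hL1; split; apply/andP; split; lra.
  + by clear -g1 g2 M0 M1 M4 hL0; rewrite /L0 in M1 hL0; split; apply/andP; split; lra.
  + by clear -M0; lra.
  + by rewrite addrC cisD2pi.
  + by apply: s0; clear -M0 M1; lra.
  + by apply: s1; clear -M0 M2; lra.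
apply: (vertex_same (a := L1 + M / 2) T _ sX) => //.
+ by rewrite -/L1; clear -hL1 ha' a2'; apply/andP; split; lra.
+ by clear -hL1 M0 M2; apply/andP; split; lra.
+ by clear -hL1 ha' a2'; apply/andP; split; lra.
+ by right; rewrite -/L1; clear -M0 ha'; split; lra.
Qed.

(** Mirror image of [right_transfer]: the edge is turned counterclockwise at v0, into the left
    sides, whose angles L0 and L1 are positive. *)
Lemma left_transfer v0 v1 v2 b0 b1 b2 f0 f1 f2 X (a a' : R) :
  tri v0 v1 v2 b0 b1 b2 f0 f1 f2 -> path_sat (crv v0 v1 v2 b0 b1 b2) X ->
  a < pi - f1 - f2 <= 2 * pi -> a' < pi - f0 - f2 <= 2 * pi -> 0 < a -> 0 < a' ->
  sec X v0 (out v0 v1 b0) a a -> sec X v1 (out v1 v2 b1) a' a'.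
Proof.
move=> T sX /andP[ha hL0] /andP[ha' hL1] a2 a2' x0.
have /andP[g1 g2] := tri_f2 T; have /andP[g3 g4] := tri_b0 T.
have T' := tri_rot (tri_rot T).
have sX' := path_sat_rot (path_sat_rot sX).
have pp := pi_gt0 R.
set L0 := pi - f1 - f2 in hL0 ha; set L1 := pi - f0 - f2 in hL1 ha'.
pose M := Num.min (Num.min L0 L1) (Num.min (pi + b0) (pi - f2)).
have M0 : 0 < M by clear -ha ha' a2 a2' g2 g3; rewrite !lt_min; apply/andP; split; apply/andP; split; lra.
have [M1 M2 M3 M4] : [/\ M <= L0, M <= L1, M <= pi + b0 & M <= pi - f2].
  by split; rewrite !ge_min lexx ?orbT.
have eL0 : pi - f2 - f1 = L0 by rewrite /L0; ring.
have s0 c1 c2 : 0 < c1 -> c1 <= c2 -> c2 < L0 ->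
    sec (fun z => ~ crv v0 v1 v2 b0 b1 b2 z) v0 (out v0 v1 b0) c1 c2.
  move=> h1 h2 h3; apply: sec_imp (vertex_sector (a1 := c1) (a2 := c2) T' _ _ _ _ _).
  + by move=> z; rewrite crv_rot2.
  + by rewrite eL0; clear -hL0 ha a2; apply/andP; split; lra.
  + by [].
  + by [].
  + by clear -hL0 h3; lra.
  + by left; rewrite eL0.
have s1 c1 c2 : 0 < c1 -> c1 <= c2 -> c2 < L1 ->
    sec (fun z => ~ crv v0 v1 v2 b0 b1 b2 z) v1 (out v1 v2 b1) c1 c2.
  move=> h1 h2 h3; apply: (vertex_sector T) => //.
  + by rewrite -/L1; clear -hL1 ha' a2'; apply/andP; split; lra.
  + by clear -hL1 h3; lra.
  + by left.
have x0' : sec X v0 (out v0 v1 b0) (M / 2) (M / 2).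
  apply: (vertex_same (a := a) T' _ sX') => //.
  + by rewrite eL0; clear -hL0 ha a2; apply/andP; split; lra.
  + by clear -hL0 ha a2; apply/andP; split; lra.
  + by clear -hL0 M0 M1; apply/andP; split; lra.
  + by left; rewrite eL0; clear -ha M0 M1; split; lra.
have x1 : sec X v1 (out v1 v2 b1) (L1 - M / 2) (L1 - M / 2).
  apply: (transfer (dl := - (M / 2)) (al := M / 2) (et := M / 4) T sX) => //.
  + by rewrite oppr_eq0 gt_eqF //; clear -M0; lra.
  + by clear -g4 M0 M3; apply/andP; split; lra.
  + by clear -hL0 M0 M1; apply/andP; split; lra.
  + by clear -g1 g2 M0 M2 M4 hL1; rewrite /L1 in M2 hL1; split; apply/andP; split; lra.
  + by clear -g1 g2 M0 M1 M4 hL0; rewrite /L0 in M1 hL0; split; apply/andP; split; lra.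
  + by clear -M0; lra.
  + by rewrite opprK.
  + by apply: s0; clear -M0 M1; lra.
  + by apply: s1; clear -M0 M2; lra.
apply: (vertex_same (a := L1 - M / 2) T _ sX) => //.
+ by rewrite -/L1; clear -hL1 ha' a2'; apply/andP; split; lra.
+ by clear -hL1 M0 M2; apply/andP; split; lra.
+ by clear -hL1 ha' a2'; apply/andP; split; lra.
+ by left; rewrite -/L1; clear -M0 ha'; split; lra.
Qed.

End Transfer.

(** * Interior angles of a simple arc-triangle *)

Section Necessity.
Variable R : realType.
Local Notation C := R[i].
Local Notation Re := (@complex.Re R).
Local Notation Im := (@complex.Im R).
Local Notation pt := (pt R).
Implicit Types (K X P : C -> Prop) (v d p q z : C) (A : carc R).

Definition csector X v u w (th : R) :=
  [/\ exists2 k : R, 0 < k & w = k%:C * (cis th * u),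
      forall al, 0 < al < th -> sec X v u al al &
      forall al, th < al < 2 * pi -> sec (fun z => ~ X z) v u al al].

Lemma ray_sec (S : set pt) (P : C -> Prop) (v u : pt) (al : R) :
  (forall z, P z <-> S (ofC z)) ->
  (exists e : R, 0 < e /\ forall t, 0 < t < e -> S (ray_pt v t (Defs.rot al u))) <->
  sec P (toC v) (toC u) al al.
Proof.
move=> PS.
have e t : ray_pt v t (Defs.rot al u) = ofC (toC v + t%:C * (cis al * toC u)).
  by rewrite /ray_pt /Defs.rot /ofC /toC !reim /=; congr pair; ring.
split=> [[r [r0 h]]|[r r0 h]]; exists r.
  by [].
  by move=> t a ht ha; have -> : a = al by [lra]; rewrite PS -e; apply: h.
by split=> // t ht; rewrite e -PS; apply: h; rewrite ?lexx.
Qed.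

Lemma sector_angleE (S : set pt) (v u w : pt) (th : R) :
  sector_angle S v u w th <-> csector (fun z => S (ofC z)) (toC v) (toC u) (toC w) th.
Proof.
have e k : w = (k * (Defs.rot th u).1, k * (Defs.rot th u).2) <-> toC w = k%:C * (cis th * toC u).
  split=> [->|h]; first by apply: complex_ext; rewrite /Defs.rot /toC !reim /=; ring.
  by rewrite -(toCK w) h /ofC /Defs.rot /toC !reim /=; congr pair; ring.
have r1 al := @ray_sec S (fun z => S (ofC z)) v u al (fun z => iff_refl _).
have r2 al := @ray_sec (~` S) (fun z => ~ S (ofC z)) v u al (fun z => iff_refl _).
split.
  move=> [[k [k0 hk]] [h1 h2]]; split; first by exists k => //; apply/e.
    by move=> al hal; apply/r1; apply: h1.
  by move=> al hal; apply/r2; apply: h2.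
move=> [[k k0 hk] h1 h2]; split; first by exists k; split => //; apply/e.
split=> al hal; [apply/r1; exact: h1|apply/r2; exact: h2].
Qed.

Lemma cis_eq_cases (x y : R) : 0 <= x <= 2 * pi -> 0 <= y <= 2 * pi -> cis x = cis y ->
  [\/ x = y, x = 0 /\ y = 2 * pi | x = 2 * pi /\ y = 0].
Proof.
move=> /andP[x0 x1] /andP[y0 y1] e.
have [h|h] := boolP (- (2 * pi) < x - y < 2 * pi).
  by apply: Or31; apply: (dirn_inj (dirn_cis x)) => //; rewrite e; exact: dirn_cis.
move: h; rewrite negb_and -!leNgt => /orP[h|h]; [apply: Or32|apply: Or33]; split; lra.
Qed.

(* An interior angle is the left angle L of the corner or the right angle 2 pi - L, and
   then X lies on the corresponding side. *)
Definition corner X v u (L th : R) :=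
  (th = L /\ (forall a, 0 < a < L -> sec X v u a a) /\
     (forall a, L < a < 2 * pi -> sec (fun z => ~ X z) v u a a)) \/
  (th = 2 * pi - L /\ (forall a, 0 < a < L -> sec (fun z => ~ X z) v u a a) /\
     (forall a, L < a < 2 * pi -> sec X v u a a)).

(** The tangents fix th modulo 2 pi, as L or as 2 pi - L according to the order of the two edges.
    When one of the compared values is 0 and the other 2 pi, the other alternative of [corner]
    holds, one of its sector conditions being vacuous. *)
Lemma vertex_angle X v u d1 d2 (L th k1 k2 : R) : u != 0 -> 0 < k1 -> 0 < k2 ->
  0 <= L <= 2 * pi -> 0 <= th <= 2 * pi ->
  d1 = k1%:C * u -> d2 = k2%:C * (cis L * u) ->
  csector X v d1 d2 th \/ csector X v d2 d1 th -> corner X v u L th.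
Proof.
move=> u0 k10 k20 /andP[L0 L1] /andP[t0 t1] e1 e2.
have f1 P a : sec P v d1 a a -> sec P v u a a.
  move=> h; apply: (@sec_frame _ P v u d1 k1^-1 0); rewrite ?invr_gt0 ?addr0 //.
  by rewrite cis0 mul1r e1 RCV mulrA mulVf ?mul1r // RC_neq0 gt_eqF.
have f2 P a : sec P v d2 (a - L) (a - L) -> sec P v u a a.
  move=> h; apply: (@sec_frame _ P v u d2 k2^-1 (- L)); rewrite ?invr_gt0 //.
  rewrite e2 RCV; transitivity ((k2%:C)^-1 * k2%:C * (cis (- L) * cis L) * u); last by ring.
  by rewrite cisNK mulVf ?mul1r // RC_neq0 gt_eqF.
have f2' P a : sec P v d2 (a - L + 2 * pi) (a - L + 2 * pi) -> sec P v u a a.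
  by move=> h; apply: f2; apply: sec_shift.
case=> -[[k k0 e] h1 h2].
- have c : cis th = cis L.
    apply: (@dirn_cis_eq _ (k2%:C * cis L)); last by exists k2.
    exists (k * k1); first by rewrite mulr_gt0.
    by apply: (mulIf u0); rewrite -!mulrA -e2 e e1 RCM; ring.
  have [] := cis_eq_cases _ _ c; rewrite ?t0 ?L0 //.
  + move=> tL; subst th; left; split => //.
    by split=> a ha; apply: f1; [apply: h1|apply: h2].
  + move=> [tt LL]; right; split; first lra.
    split=> a /andP[? ?]; first by apply: f1; apply: h2; apply/andP; split; lra.
    lra.
  + move=> [tt LL]; right; split; first lra.
    split=> a /andP[? ?]; last by apply: f1; apply: h1; apply/andP; split; lra.
    lra.
- have c : cis th = cis (2 * pi - L).
    rewrite addrC cisD2pi.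
    apply: (@dirn_cis_eq _ (k1%:C * cis (- L))); last by exists k1.
    exists (k * k2); first by rewrite mulr_gt0.
    apply: (mulIf u0); rewrite -!mulrA; apply/esym.
    have : cis (- L) * d1 = cis (- L) * (k%:C * (cis th * d2)) by rewrite e.
    rewrite e1 e2 RCM => h; transitivity (cis (- L) * (k%:C * (cis th * (k2%:C * (cis L * u))))).
      transitivity (k%:C * k2%:C * (cis th * u) * (cis (- L) * cis L)); last by ring.
      by rewrite cisNK mulr1.
    by rewrite -h; ring.
  have [] := cis_eq_cases _ _ c; rewrite ?t0 //; first by apply/andP; split; lra.
  + move=> tL; subst th; right; split => //.
    split=> a /andP[? ?]; first by apply: f2'; apply: h2; apply/andP; split; lra.
    by apply: f2; apply: h1; apply/andP; split; lra.
  + move=> [tt LL]; have LL0 : L = 0 by lra.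
    left; split; first lra.
    split=> a /andP[? ?]; first lra.
    by apply: f2; apply: h2; apply/andP; split; lra.
  + move=> [tt LL]; have LL0 : L = 2 * pi by lra.
    left; split; first lra.
    split=> a /andP[? ?]; last lra.
    by apply: f2'; apply: h1; apply/andP; split; lra.
Qed.

(** The alternative of [corner] that holds at v0 is carried to v1 and v2, for X or for its
    complement, and [sec_disj] refutes the opposite one there. The two outcomes are the two
    orientations. *)
Lemma angles_consistent v0 v1 v2 b0 b1 b2 f0 f1 f2 X (th0 th1 th2 : R) :
  tri v0 v1 v2 b0 b1 b2 f0 f1 f2 -> path_sat (crv v0 v1 v2 b0 b1 b2) X ->
  - pi <= f2 + f0 <= pi -> - pi <= f0 + f1 <= pi -> - pi <= f1 + f2 <= pi ->
  corner X v0 (out v0 v1 b0) (pi - f1 - f2) th0 ->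
  corner X v1 (out v1 v2 b1) (pi - f0 - f2) th1 ->
  corner X v2 (out v2 v0 b2) (pi - f0 - f1) th2 ->
  [/\ th0 = pi - f1 - f2, th1 = pi - f0 - f2 & th2 = pi - f0 - f1] \/
  [/\ th0 = pi + f1 + f2, th1 = pi + f0 + f2 & th2 = pi + f0 + f1].
Proof.
move=> T sX /andP[h1 h2] /andP[h3 h4] /andP[h5 h6] c0 c1 c2.
have T1 := tri_rot T; have sX1 := path_sat_rot sX.
have nX := path_sat_compl sX; have nX1 := path_sat_rot nX.
have [/andP[a1 a2] [/andP[a3 a4] /andP[a5 a6]]] := (tri_f0 T, (tri_f1 T, tri_f2 T)).
set L0 := pi - f1 - f2 in c0; set L1 := pi - f0 - f2 in c1; set L2 := pi - f0 - f1 in c2.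
(* A left angle 2 pi makes two of the f_i negative, a left angle 0 makes two of them positive; among
   three numbers both cannot happen. *)
have [[r0 [r1 r2]]|[l0 [l1 l2]]] :
    (L0 < 2 * pi /\ L1 < 2 * pi /\ L2 < 2 * pi) \/ (0 < L0 /\ 0 < L1 /\ 0 < L2).
  clear -a1 a2 a3 a4 a5 a6 h1 h2 h3 h4 h5 h6.
  case: (ltP L0 (2 * pi)) => q0; last by right; rewrite /L0 /L1 /L2 in q0 *; split; [|split]; lra.
  case: (ltP L1 (2 * pi)) => q1; last by right; rewrite /L0 /L1 /L2 in q0 q1 *; split; [|split]; lra.
  case: (ltP L2 (2 * pi)) => q2; last by right; rewrite /L0 /L1 /L2 in q0 q1 q2 *; split; [|split]; lra.
  by left.
- pose m0 := (L0 + 2 * pi) / 2; pose m1 := (L1 + 2 * pi) / 2; pose m2 := (L2 + 2 * pi) / 2.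
  have [i0 i1 i2] : [/\ L0 < m0 < 2 * pi, L1 < m1 < 2 * pi & L2 < m2 < 2 * pi].
    by clear -r0 r1 r2; split; apply/andP; rewrite /m0 /m1 /m2; split; lra.
  have t01 Y : path_sat (crv v0 v1 v2 b0 b1 b2) Y ->
      sec Y v0 (out v0 v1 b0) m0 m0 -> sec Y v1 (out v1 v2 b1) m1 m1.
    move=> sY; apply: (right_transfer T sY); rewrite ?[_ < 2 * pi](andP i0).2 ?(andP i1).2 //.
      by rewrite -/L0 (andP i0).1 andbT /L0; clear -h6; lra.
    by rewrite -/L1 (andP i1).1 andbT /L1; clear -h2; lra.
  have t12 Y : path_sat (crv v1 v2 v0 b1 b2 b0) Y ->
      sec Y v1 (out v1 v2 b1) m1 m1 -> sec Y v2 (out v2 v0 b2) m2 m2.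
    have E1 : pi - f2 - f0 = L1 by rewrite /L1; ring.
    have E2 : pi - f1 - f0 = L2 by rewrite /L2; ring.
    move=> sY; apply: (right_transfer T1 sY); rewrite ?(andP i1).2 ?(andP i2).2 //.
      by rewrite E1 (andP i1).1 andbT /L1; clear -h2; lra.
    by rewrite E2 (andP i2).1 andbT /L2; clear -h4; lra.
  case: c0 => -[e0 [_ x0]].
  + left; have x1 := t01 _ nX (x0 _ i0); have x2 := t12 _ nX1 x1.
    case: c1 => -[e1 [_ y1]]; last by case: (sec_disj (y1 _ i1) x1).
    case: c2 => -[e2 [_ y2]]; last by case: (sec_disj (y2 _ i2) x2).
    by rewrite e0 e1 e2.
  + right; have x1 := t01 _ sX (x0 _ i0); have x2 := t12 _ sX1 x1.
    case: c1 => -[e1 [_ y1]]; first by case: (sec_disj x1 (y1 _ i1)).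
    case: c2 => -[e2 [_ y2]]; first by case: (sec_disj x2 (y2 _ i2)).
    by rewrite e0 e1 e2 /L0 /L1 /L2; split; ring.
- pose m0 := L0 / 2; pose m1 := L1 / 2; pose m2 := L2 / 2.
  have [i0 i1 i2] : [/\ 0 < m0 < L0, 0 < m1 < L1 & 0 < m2 < L2].
    by clear -l0 l1 l2; split; apply/andP; rewrite /m0 /m1 /m2; split; lra.
  have t01 Y : path_sat (crv v0 v1 v2 b0 b1 b2) Y ->
      sec Y v0 (out v0 v1 b0) m0 m0 -> sec Y v1 (out v1 v2 b1) m1 m1.
    move=> sY; apply: (left_transfer T sY); rewrite ?(andP i0).1 ?(andP i1).1 //.
      by rewrite -/L0 (andP i0).2 /L0 /=; clear -h5; lra.
    by rewrite -/L1 (andP i1).2 /L1 /=; clear -h1; lra.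
  have t12 Y : path_sat (crv v1 v2 v0 b1 b2 b0) Y ->
      sec Y v1 (out v1 v2 b1) m1 m1 -> sec Y v2 (out v2 v0 b2) m2 m2.
    have E1 : pi - f2 - f0 = L1 by rewrite /L1; ring.
    have E2 : pi - f1 - f0 = L2 by rewrite /L2; ring.
    move=> sY; apply: (left_transfer T1 sY); rewrite ?(andP i1).1 ?(andP i2).1 //.
      by rewrite E1 (andP i1).2 /L1 /=; clear -h1; lra.
    by rewrite E2 (andP i2).2 /L2 /=; clear -h3; lra.
  case: c0 => -[e0 [x0 _]].
  + left; have x1 := t01 _ sX (x0 _ i0); have x2 := t12 _ sX1 x1.
    case: c1 => -[e1 [y1 _]]; last by case: (sec_disj x1 (y1 _ i1)).
    case: c2 => -[e2 [y2 _]]; last by case: (sec_disj x2 (y2 _ i2)).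
    by rewrite e0 e1 e2.
  + right; have x1 := t01 _ nX (x0 _ i0); have x2 := t12 _ nX1 x1.
    case: c1 => -[e1 [y1 _]]; first by case: (sec_disj (y1 _ i1) x1).
    case: c2 => -[e2 [y2 _]]; first by case: (sec_disj (y2 _ i2) x2).
    by rewrite e0 e1 e2 /L0 /L1 /L2; split; ring.
Qed.

(** * Edges given by centre, radius and sweep; the angle between chord and tangent is half the
    sweep *)

Definition bulge A : R := match A with Seg _ _ => 0 | Circ _ _ _ s => s / 2 end.

(** A chord of the unit circle is orthogonal to the bisecting direction a + x and has signed length
    2 sin x. *)
Lemma cis_sub (a x : R) : cis (a + 2 * x) - cis a = cis (a + x) * (0 +i* (2 * sin x)).
Proof.
have -> : cis (a + 2 * x) = cis (a + x) * cis x by rewrite -cisD; congr cis; ring.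
have -> : cis a = cis (a + x) * cis (- x) by rewrite -cisD; congr cis; ring.
by rewrite -mulrBr; congr (_ * _); apply: complex_ext; rewrite !reim /= ?cosN ?sinN; ring.
Qed.

Lemma toC_circ (c : pt) (r a s t : R) :
  toC (arc_pt (Circ c r a s) t) = toC c + r%:C * cis (a + 2 * (t * (s / 2))).
Proof.
have -> : a + 2 * (t * (s / 2)) = a + t * s by field.
by apply: complex_ext; rewrite /toC !reim /=; ring.
Qed.

Lemma bulge_bound A : wf_arc A -> - pi < bulge A < pi.
Proof.
case: A => [p q _|c r a s [_ /andP[_]]] /=; first by rewrite oppr_lt0 pi_gt0.
by rewrite ltr_norml => /andP[? ?]; apply/andP; split; lra.
Qed.

Lemma sin_bulge c (r a s : R) : wf_arc (Circ c r a s) -> sin (s / 2) != 0.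
Proof.
move=> w; have := bulge_bound w; case: w => _ /andP[s0 _] /= h.
by apply: sin_neq0 => //; rewrite mulf_neq0 ?invr_eq0 // -normr_gt0.
Qed.

Lemma chord_circ c (r a s : R) : toC (arc_pt (Circ c r a s) 1) - toC (arc_pt (Circ c r a s) 0) =
  r%:C * (cis (a + s / 2) * (0 +i* (2 * sin (s / 2)))).
Proof. by rewrite !toC_circ !mul1r !mul0r mulr0 addr0 -cis_sub; ring. Qed.

Lemma im_neq0 (x : R) : x != 0 -> (0 +i* x : C) != 0.
Proof. by move=> h; apply/eqP => -[e]; rewrite e eqxx in h. Qed.

Lemma carc_ends A : wf_arc A -> toC (arc_pt A 0) != toC (arc_pt A 1).
Proof.
case: A => [p q w|c r a s w].
  apply/eqP => /(can_inj (@toCK R)); rewrite /= !mul0r !mul1r !addr0 ![_ + (_ - _)]addrC !subrK => h.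
  by apply: w; rewrite [p]surjective_pairing [q]surjective_pairing.
rewrite eq_sym -subr_eq0 chord_circ !mulf_neq0 ?cis_neq0 ?im_neq0 ?mulf_neq0 ?(sin_bulge w) //.
by rewrite RC_neq0 gt_eqF //; case: w.
Qed.

(** The two parametrizations agree even in the parameter: by [cis_sub] the chord of the part swept
    by t s makes the angle t s / 2 with the tangent at the start. *)
Lemma carc_apt A t : wf_arc A ->
  toC (arc_pt A t) = apt (toC (arc_pt A 0)) (toC (arc_pt A 1)) (bulge A) t.
Proof.
case: A => [p q w|c r a s w].
  rewrite /apt /chord eqxx mulr0 oppr0 cis0 mulr1.
  by apply: complex_ext; rewrite /toC !reim /=; ring.
rewrite /apt chord_circ [bulge _]/= /chord.
have s0 := sin_bulge w.
have -> : (s / 2 == 0) = false by apply: contraNF s0 => /eqP ->; rewrite sin0.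
rewrite !toC_circ mul0r mulr0 addr0 -addrA; congr (_ + _).
have -> : cis (a + 2 * (t * (s / 2))) = cis a + cis (a + t * (s / 2)) * (0 +i* (2 * sin (t * (s / 2)))).
  by rewrite -cis_sub; ring.
have -> : a + t * (s / 2) = (a + s / 2) + - ((1 - t) * (s / 2)) by ring.
have -> : (0 +i* (2 * sin (t * (s / 2)))) = (0 +i* (2 * sin (s / 2))) * (sin (t * (s / 2)) / sin (s / 2))%:C :> C.
  by apply: complex_ext; rewrite !reim /=; field.
by rewrite (cisD (a + s / 2)); ring.
Qed.

Lemma carc_tan A : wf_arc A -> exists2 k : R, 0 < k &
  toC (arc_tan A 0) = k%:C * (cis (- bulge A) * (toC (arc_pt A 1) - toC (arc_pt A 0))) /\
  toC (arc_tan A 1) = k%:C * (cis (bulge A) * (toC (arc_pt A 1) - toC (arc_pt A 0))).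
Proof.
case: A => [p q w|c r a s w].
  exists 1 => //; rewrite [bulge _]/= oppr0 cis0.
  by split; apply: complex_ext; rewrite /toC !reim /=; ring.
have s0 := sin_bulge w; have hb := bulge_bound w; rewrite /= in hb.
have [r0 sp] : 0 < r /\ s != 0 by case: w => ? /andP[h _]; rewrite -normr_gt0.
(* Speed of the parametrization divided by the length of the chord. *)
exists (s / (2 * sin (s / 2))).
  case: (ltgtP s 0) sp => // hs _.
    have : 0 < sin (- (s / 2)) by apply: sin_gt0_pi; move/andP: hb => [? ?]; apply/andP; split; lra.
    rewrite sinN oppr_gt0 => h.
    by rewrite -mulrNN -invrN mulr_gt0 ?oppr_gt0 // invr_gt0; lra.
  have h : 0 < sin (s / 2) by apply: sin_gt0_pi; move/andP: hb => [? ?]; apply/andP; split; lra.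
  by rewrite divr_gt0 // mulr_gt0.
have E : (s / (2 * sin (s / 2)))%:C * (0 +i* (2 * sin (s / 2))) = 0 +i* s :> C.
  by apply: complex_ext; rewrite !reim /=; field.
rewrite chord_circ [bulge _]/=; split.
  transitivity (r%:C * ((cis (- (s / 2)) * cis (a + s / 2)) * (0 +i* s))); last by rewrite -E; ring.
  have -> : cis (- (s / 2)) * cis (a + s / 2) = cis (a + 0 * s) by rewrite -cisD; congr cis; ring.
  by apply: complex_ext; rewrite /toC !reim /=; ring.
transitivity (r%:C * ((cis (s / 2) * cis (a + s / 2)) * (0 +i* s))); last by rewrite -E; ring.
have -> : cis (s / 2) * cis (a + s / 2) = cis (a + 1 * s) by rewrite -cisD; congr cis; field.
by apply: complex_ext; rewrite /toC !reim /=; ring.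
Qed.

Lemma arc_setE A z : wf_arc A ->
  arc_set A (ofC z) <-> onarc (toC (arc_pt A 0)) (toC (arc_pt A 1)) (bulge A) z.
Proof.
move=> w; rewrite (onarcP _ (carc_ends w) (bulge_bound w)); split.
  by move=> [t]; rewrite /= in_itv /= => ht e; exists t => //; rewrite -carc_apt // e ofCK.
move=> [t ht e]; exists t; first by rewrite /= in_itv.
by apply: (can_inj (@toCK R)); rewrite ofCK e carc_apt.
Qed.

(** The vertex opposite to an edge lies on the next edge and is not the vertex they share.
    Simplicity therefore keeps it off the edge, and the argument of F there is defined. *)
Lemma arc_triangle_tri (u0 u1 u2 : pt) (e0 e1 e2 : carc R) :
  arc_triangle u0 u1 u2 e0 e1 e2 -> simple_triangle u0 u1 u2 e0 e1 e2 ->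
  exists f0 f1 f2 : R,
    tri (toC u0) (toC u1) (toC u2) (bulge e0) (bulge e1) (bulge e2) f0 f1 f2.
Proof.
move=> [[w0 w1 w2] [[p0 q0] [p1 q1] [p2 q2]]] [s01 [s12 s20]].
have E0 z := arc_setE z w0; have E1 z := arc_setE z w1; have E2 z := arc_setE z w2.
have n0 := carc_ends w0; have n1 := carc_ends w1; have n2 := carc_ends w2.
rewrite p0 q0 in E0 n0; rewrite p1 q1 in E1 n1; rewrite p2 q2 in E2 n2.
have opp (e e' : carc R) (v v' u : pt) p q b : arc_set e `&` arc_set e' = [set v'] ->
    toC v' != toC v -> arc_set e' v -> (forall z, arc_set e (ofC z) <-> onarc p q b z) ->
    ~ onarc p q b (toC v).
  move=> s n ve' E on; have : (arc_set e `&` arc_set e') v by split => //; rewrite -(toCK v) E.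
  by rewrite s => h; rewrite h eqxx in n.
have polar' z : ~ negray z -> exists2 f : R, - pi < f < pi & dirn z f.
  by move=> h; exists (Arg z); [exact: Arg_bound|exact: Arg_dirn].
have m1 : arc_set e1 u2 by exists 1 => //=; rewrite in_itv /= lexx ler01.
have m2 : arc_set e2 u0 by exists 1 => //=; rewrite in_itv /= lexx ler01.
have m0 : arc_set e0 u1 by exists 1 => //=; rewrite in_itv /= lexx ler01.
have [f2 f2P F0] := polar' _ (opp _ _ u2 u1 u0 _ _ _ s01 n1 m1 E0).
have [f0 f0P F1] := polar' _ (opp _ _ u0 u2 u0 _ _ _ s12 n2 m2 E1).
have [f1 f1P F2] := polar' _ (opp _ _ u1 u0 u0 _ _ _ s20 n0 m0 E2).
by exists f0, f1, f2; split => //; exact: bulge_bound.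
Qed.

Lemma toC_neg (u : pt) : toC (neg_pt u) = - toC u.
Proof. by []. Qed.

Lemma interior_angle_corner (S : set pt) (u0 u1 u2 : pt) (e0 e1 : carc R) b2 f0 f1 f2 th :
  wf_arc e0 -> wf_arc e1 -> arc_pt e0 0 = u0 -> arc_pt e0 1 = u1 ->
  arc_pt e1 0 = u1 -> arc_pt e1 1 = u2 ->
  tri (toC u0) (toC u1) (toC u2) (bulge e0) (bulge e1) b2 f0 f1 f2 ->
  - pi <= f2 + f0 <= pi ->
  interior_angle S u1 (arc_tan e1 0) (neg_pt (arc_tan e0 1)) th ->
  corner (fun z => S (ofC z)) (toC u1) (out (toC u1) (toC u2) (bulge e1)) (pi - f0 - f2) th.
Proof.
move=> w0 w1 p0 q0 p1 q1 T /andP[h1 h2] [tP sP].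
have [k0 k00 [_ t0]] := carc_tan w0; have [k1 k10 [t1 _]] := carc_tan w1.
rewrite p0 q0 in t0; rewrite p1 q1 in t1.
have [l l0 tg] := tangent_angle T.
apply: (@vertex_angle _ _ _ (toC (arc_tan e1 0)) (toC (neg_pt (arc_tan e0 1))) _ _ k1 (k0 * l)) => //.
- by rewrite mulf_neq0 ?cis_neq0 // subr_eq0 eq_sym (tri_v12 T).
- by rewrite mulr_gt0.
- by apply/andP; split; lra.
- rewrite toC_neg t0 RCM -mulrA -[X in _ = _ * X]tg; ring.
- by rewrite -!sector_angleE.
Qed.

Theorem angles_bounded (th0 th1 th2 : R) (u0 u1 u2 : pt) (e0 e1 e2 : carc R) :
  arc_triangle u0 u1 u2 e0 e1 e2 -> simple_triangle u0 u1 u2 e0 e1 e2 ->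
  triangle_angles u0 u1 u2 e0 e1 e2 th0 th1 th2 ->
  let psi := (pi - th0 - th1 - th2) / 2 in
  [/\ - pi < psi + th0 < pi, - pi < psi + th1 < pi & - pi < psi + th2 < pi].
Proof.
move=> tr si [i0 i1 i2] psi.
have [f0 [f1 [f2 T]]] := arc_triangle_tri tr si.
move: tr si => [[w0 w1 w2] [[p0 q0] [p1 q1] [p2 q2]]] [s01 [s12 s20]].
have E0 z := arc_setE z w0; have E1 z := arc_setE z w1; have E2 z := arc_setE z w2.
rewrite p0 q0 in E0; rewrite p1 q1 in E1; rewrite p2 q2 in E2.
have T1 := tri_rot T; have T2 := tri_rot T1.
have meet (e e' : carc R) (v : pt) z : arc_set e `&` arc_set e' = [set v] ->
    arc_set e (ofC z) -> arc_set e' (ofC z) -> z = toC v.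
  by move=> s h h'; have : (arc_set e `&` arc_set e') (ofC z) by []; rewrite s => <-; rewrite ofCK.
have a20 : - pi <= f2 + f0 <= pi.
  by apply: (angle_sum_bound T) => z /E0 h /E1 h'; exact: meet s01 h h'.
have a01 : - pi <= f0 + f1 <= pi.
  by apply: (angle_sum_bound T1) => z /E1 h /E2 h'; exact: meet s12 h h'.
have a12 : - pi <= f1 + f2 <= pi.
  by apply: (angle_sum_bound T2) => z /E2 h /E0 h'; exact: meet s20 h h'.
set S := interior_of _ in i0 i1 i2.
have sX : path_sat (crv (toC u0) (toC u1) (toC u2) (bulge e0) (bulge e1) (bulge e2)) (fun z => S (ofC z)).
  move=> g a b cr ci ab av; apply: interior_path_sat => // t ht.
  move=> h; apply: (av t ht); case: h => [[/E0 h|/E1 h]|/E2 h].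
  - exact: Or31. - exact: Or32. - exact: Or33.
have c1 := interior_angle_corner w0 w1 p0 q0 p1 q1 T a20 i1.
have c2 := interior_angle_corner w1 w2 p1 q1 p2 q2 T1 a01 i2.
have c0 := interior_angle_corner w2 w0 p2 q2 p0 q0 T2 a12 i0.
have e1' : pi - f1 - f0 = pi - f0 - f1 by ring.
have e2' : pi - f2 - f1 = pi - f1 - f2 by ring.
rewrite e1' in c2; rewrite e2' in c0.
have [/andP[g1 g2] [/andP[g3 g4] /andP[g5 g6]]] := (tri_f0 T, (tri_f1 T, tri_f2 T)).
(* Here psi + th_i is f_i in the first case and - f_i in the second. *)
rewrite /psi; case: (angles_consistent T sX a20 a01 a12 c0 c1 c2) => -[-> -> ->].
  by split; apply/andP; split; lra.
by split; apply/andP; split; lra.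
Qed.

End Necessity.

(** * Winding number *)

Section Sufficiency.
Variable R : realType.
Local Notation C := R[i].
Local Notation Re := (@complex.Re R).
Local Notation Im := (@complex.Im R).
Local Notation pt := (pt R).
Implicit Types (K X P : C -> Prop) (v d p q z : C).

Lemma carc_exists p q (b : R) : p != q -> - pi < b < pi ->
  exists A : carc R, [/\ wf_arc A, arc_pt A 0 = ofC p, arc_pt A 1 = ofC q & bulge A = b].
Proof.
move=> pq hb; have [->|b0] := eqVneq b 0.
  exists (Seg (ofC p) (ofC q)); split => //=.
  - by move=> /(can_inj (@ofCK R)) /eqP; rewrite (negbTE pq).
  - by rewrite !mul0r !addr0.
  - by rewrite !mul1r ![_ + (_ - _)]addrC !subrK.
have s0 := sin_neq0 hb b0.
have w0 : (0 +i* (2 * sin b) : C) != 0 by apply: im_neq0; rewrite mulf_neq0.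
have z0 : (q - p) / (0 +i* (2 * sin b)) != 0.
  by rewrite mulf_neq0 ?invr_eq0 // subr_eq0 eq_sym.
(* The circle comes from q - p = 2 i sin b r cis al: its radius is r, and p and q sit at angles al -
   b and al + b. A negative sin b is absorbed by al, so r > 0. *)
have [al [_ [r r0 e]]] := polar z0.
have e' : r%:C * (cis (al - b + 2 * b) - cis (al - b)) = q - p.
  by rewrite cis_sub subrK mulrA -e divfK.
have w : wf_arc (Circ (ofC (p - r%:C * cis (al - b))) r (al - b) (2 * b)).
  split => //; rewrite normr_gt0 mulf_neq0 //=.
  by move/andP: hb => [? ?]; rewrite ltr_norml; apply/andP; split; lra.
exists (Circ (ofC (p - r%:C * cis (al - b))) r (al - b) (2 * b)); split => //.
- by apply: (can_inj (@toCK R)); rewrite toC_circ !ofCK mul0r mulr0 addr0 subrK.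
- apply: (can_inj (@toCK R)); rewrite toC_circ !ofCK mul1r mulrAC mulfV // mul1r.
  have -> : p - r%:C * cis (al - b) + r%:C * cis (al - b + 2 * b) = p + r%:C * (cis (al - b + 2 * b) - cis (al - b)) by ring.
  by rewrite e'; ring.
- by rewrite /= mulrAC mulfV // mul1r.
Qed.

(** * Continuity of the argument, and the winding number away from the curve *)

Lemma continuous_Arg (T : topologicalType) (g : T -> C) (x : T) :
  (fun y => Re (g y)) @ x --> Re (g x) -> (fun y => Im (g y)) @ x --> Im (g x) ->
  ~ negray (g x) -> (fun y => Arg (g y)) @ x --> Arg (g x).
Proof.
move=> cr ci n; rewrite /Arg.
have cs : (fun y => sqn (g y)) @ x --> sqn (g x).
  by rewrite /sqn; apply: cvgD; rewrite !expr2; apply: cvgM.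
have cq : (fun y => Num.sqrt (sqn (g y))) @ x --> Num.sqrt (sqn (g x)).
  exact: (cvg_comp _ _ cs (@sqrt_continuous R _)).
have cd : (fun y => Im (g y) / (Re (g y) + Num.sqrt (sqn (g y)))) @ x -->
    Im (g x) / (Re (g x) + Num.sqrt (sqn (g x))).
  apply: cvgM => //; apply: cvgV; first by rewrite gt_eqF // Arg_den_gt0.
  exact: cvgD.
by apply: cvgMr; exact: (cvg_comp _ _ cd (@continuous_atan R _)).
Qed.

Lemma ArgZ z (k : R) : 0 < k -> ~ negray z -> Arg (k%:C * z) = Arg z.
Proof.
by move=> k0 n; apply: ArgE; [exact: Arg_bound|apply: dirnZ => //; exact: Arg_dirn].
Qed.

(* b + Arg (F p q b z) is the variation of the argument of w - z as w runs along the arc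
   from p to q, so the sum over the three edges is 2 pi times the winding number. *)
Definition winding v0 v1 v2 (b0 b1 b2 : R) z : R :=
  (b0 + Arg (F v0 v1 b0 z)) + (b1 + Arg (F v1 v2 b1 z)) + (b2 + Arg (F v2 v0 b2 z)).

(** Since cis b F is (q - z) conj (p - z), the product over the closed triangle is a product of
    squared norms, hence a positive real. *)
Lemma winding_integral v0 v1 v2 b0 b1 b2 z :
  ~ crv v0 v1 v2 b0 b1 b2 z -> cis (winding v0 v1 v2 b0 b1 b2 z) = 1.
Proof.
move=> n.
have n0 : ~ onarc v0 v1 b0 z by move=> h; apply: n; exact: Or31.
have n1 : ~ onarc v1 v2 b1 z by move=> h; apply: n; exact: Or32.
have n2 : ~ onarc v2 v0 b2 z by move=> h; apply: n; exact: Or33.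
have z0 : v0 - z != 0 by rewrite subr_eq0; apply/eqP => h; apply: n0; rewrite -h; exact: onarc_start.
have z1 : v1 - z != 0 by rewrite subr_eq0; apply/eqP => h; apply: n1; rewrite -h; exact: onarc_start.
have z2 : v2 - z != 0 by rewrite subr_eq0; apply/eqP => h; apply: n2; rewrite -h; exact: onarc_start.
have d p q b : ~ onarc p q b z -> dirn ((q - z) * cj (p - z)) (b + Arg (F p q b z)).
  move=> h; have -> : (q - z) * cj (p - z) = cis b * F p q b z.
    by rewrite /F !mulrA cisKN mul1r.
  by apply: dirnM; [exact: dirn_cis|exact: Arg_dirn].
have D := dirnM (dirnM (d _ _ _ n0) (d _ _ _ n1)) (d _ _ _ n2).
rewrite -/(winding v0 v1 v2 b0 b1 b2 z) in D.
rewrite -(cis0 R); apply: (dirn_cis_eq D).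
exists (sqn (v0 - z) * sqn (v1 - z) * sqn (v2 - z)); first by rewrite !mulr_gt0 ?sqn_gt0.
by rewrite cis0 mulr1 !RCM -!mulCJ; ring.
Qed.

Lemma continuous_winding v0 v1 v2 b0 b1 b2 (x : pt) :
  ~ crv v0 v1 v2 b0 b1 b2 (toC x) ->
  (fun y : pt => winding v0 v1 v2 b0 b1 b2 (toC y)) @ x --> winding v0 v1 v2 b0 b1 b2 (toC x).
Proof.
move=> n; have c p q b : ~ onarc p q b (toC x) ->
    (fun y : pt => b + Arg (F p q b (toC y))) @ x --> b + Arg (F p q b (toC x)).
  move=> h; apply: cvgD; first exact: cvg_cst.
  apply: (@continuous_Arg _ (fun y => F p q b (toC y))) => //.
    exact: continuous_ReF.
  exact: continuous_ImF.
rewrite /winding; apply: cvgD; first apply: cvgD; apply: c => h; apply: n.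
- exact: Or31.
- exact: Or32.
- exact: Or33.
Qed.

(* Near infinity: F p q b z = |z|^2 Finf p q b (1 / z). *)
Definition Finf p q (b : R) w : C := cis (- b) * (q * w - 1) * cj (p * w - 1).

Lemma Finf_cvg p q (b : R) (x : pt) :
  (fun y : pt => Re (Finf p q b (toC y))) @ x --> Re (Finf p q b (toC x)) /\
  (fun y : pt => Im (Finf p q b (toC y))) @ x --> Im (Finf p q b (toC x)).
Proof.
have c1 : (fun x : pt => x.1) @ x --> x.1 by exact: cvg_fst.
have c2 : (fun x : pt => x.2) @ x --> x.2 by exact: cvg_snd.
have k (c : R) : (fun _ : pt => c) @ x --> c by exact: cvg_cst.
have A q' : (fun y : pt => Re q' * y.1 - Im q' * y.2 - 1) @ x --> Re q' * x.1 - Im q' * x.2 - 1.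
  by apply: cvgB => //; apply: cvgB; apply: cvgM.
have B q' : (fun y : pt => Re q' * y.2 + Im q' * y.1) @ x --> Re q' * x.2 + Im q' * x.1.
  by apply: cvgD; apply: cvgM.
pose rr (y : pt) := (Re q * y.1 - Im q * y.2 - 1) * (Re p * y.1 - Im p * y.2 - 1) +
  (Re q * y.2 + Im q * y.1) * (Re p * y.2 + Im p * y.1).
pose ii (y : pt) := (Re q * y.2 + Im q * y.1) * (Re p * y.1 - Im p * y.2 - 1) -
  (Re q * y.1 - Im q * y.2 - 1) * (Re p * y.2 + Im p * y.1).
have cr : rr @ x --> rr x by apply: cvgD; apply: cvgM.
have ci : ii @ x --> ii x by apply: cvgB; apply: cvgM.
have er y : Re (Finf p q b (toC y)) = cos b * rr y + sin b * ii y.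
  by rewrite /Finf /rr /ii !reim /= cosN sinN; ring.
have ei y : Im (Finf p q b (toC y)) = cos b * ii y - sin b * rr y.
  by rewrite /Finf /rr /ii !reim /= cosN sinN; ring.
split.
  rewrite er (_ : (fun y => _) = (fun y => cos b * rr y + sin b * ii y)); last by apply/funext.
  by apply: cvgD; apply: cvgM.
rewrite ei (_ : (fun y => _) = (fun y => cos b * ii y - sin b * rr y)); last by apply/funext.
by apply: cvgB; apply: cvgM.
Qed.

(** At w = 0 the value of [Finf] is cis (- b), so each of the three terms b + Arg tends to 0 at
    infinity. *)
Lemma winding_far v0 v1 v2 b0 b1 b2 :
  - pi < b0 < pi -> - pi < b1 < pi -> - pi < b2 < pi ->
  exists2 M : R, 0 < M & forall z, ~ crv v0 v1 v2 b0 b1 b2 z ->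
    M < `|Re z| \/ M < `|Im z| -> winding v0 v1 v2 b0 b1 b2 z < pi.
Proof.
move=> hb0 hb1 hb2.
pose H (x : pt) := (b0 + Arg (Finf v0 v1 b0 (toC x))) + (b1 + Arg (Finf v1 v2 b1 (toC x))) +
  (b2 + Arg (Finf v2 v0 b2 (toC x))).
have at0 p q b : Finf p q b (toC ((0, 0) : pt)) = cis (- b).
  by apply: complex_ext; rewrite /Finf !reim /=; ring.
have opp (b : R) : - pi < b < pi -> - pi < - b < pi.
  by move=> /andP[? ?]; apply/andP; split; lra.
have n p q b : - pi < b < pi -> ~ negray (Finf p q b (toC ((0, 0) : pt))).
  by move=> h; rewrite at0; apply: (dirn_not_negray (opp _ h) (dirn_cis _)).
have cA p q b : - pi < b < pi -> (fun y : pt => b + Arg (Finf p q b (toC y))) @ ((0, 0) : pt) --> (0 : R).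
  move=> h; rewrite -[X in _ --> X](subrr b); apply: cvgD; first exact: cvg_cst.
  have -> : - b = Arg (Finf p q b (toC ((0, 0) : pt))).
    by rewrite at0 (ArgE (opp _ h) (dirn_cis _)).
  have [c1 c2] := Finf_cvg p q b (0, 0).
  by apply: (@continuous_Arg _ (fun y => Finf p q b (toC y))) => //; exact: n.
have cH : H @ ((0, 0) : pt) --> (0 : R).
  rewrite -[X in _ --> X](addr0 (0 : R)) -[X in _ --> X + _](addr0 (0 : R)).
  by apply: cvgD; [apply: cvgD|]; apply: cA.
have : \forall x \near nbhs ((0, 0) : pt), `|H x| < pi.
  by exact: cvgr0_norm_lt cH _ (pi_gt0 R).
move=> /nbhs_ballP[e /= e0 he].
have e1 : 0 < e^-1 by rewrite invr_gt0.
exists e^-1 => // z nz far.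
have z0 : z != 0.
  by apply/eqP => z0; case: far; rewrite z0 /= normr0 => h; lra.
have N0 := sqn_gt0 z0.
(* The coordinates of 1 / z are s / (s^2 + t^2) up to sign, so this places 1 / z in the ball of
   radius e around 0. *)
have key (s t : R) : e^-1 < `|s| \/ e^-1 < `|t| -> `|s| < e * (s ^+ 2 + t ^+ 2) \/ s = 0.
  move=> h; have [s0|s0] := eqVneq s 0; [by right|left].
  have sp : 0 < `|s| by rewrite normr_gt0.
  have tp : 0 <= `|t| by [].
  rewrite -ltr_pdivrMl // -(real_normK (num_real s)) -(real_normK (num_real t)).
  move: sp tp h; move: `|s| `|t| => x y x0 y0.
  case=> h; first by have h1 : 0 < x * (x - e^-1) by [rewrite mulr_gt0 // subr_gt0]; have := sqr_ge0 y; nra.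
  have h1 : 0 < x * (y - e^-1) by rewrite mulr_gt0 // subr_gt0.
  have h2 : 0 <= (x - y) ^+ 2 by rewrite sqr_ge0.
  by have h3 := sqr_ge0 y; have h4 : 0 < x ^+ 2 by [rewrite exprn_gt0]; nra.
have zi : z^-1 = toC (Re z / sqn z, - Im z / sqn z).
  apply: (mulfI z0); rewrite mulfV //.
  have sn : sqn z != 0 by rewrite gt_eqF.
  apply: complex_ext; rewrite !reim /=; last by field.
  by apply: (mulIf sn); rewrite mul1r {1}/sqn; field.
have Hlt : `|H (Re z / sqn z, - Im z / sqn z)| < pi.
  apply: he; split; rewrite /ball /= sub0r normrN normrM (gtr0_norm (x := (sqn z)^-1)) ?invr_gt0 //.
    rewrite ltr_pdivrMr //; case: (key _ _ far) => // ->.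
    by rewrite normr0 mulr_gt0.
  rewrite normrN ltr_pdivrMr //; case: (key (Im z) (Re z)) => //.
  + by case: far; [right|left].
  + by rewrite addrC.
  + by move=> ->; rewrite normr0 mulr_gt0.
have E p q b : ~ onarc p q b z -> Arg (Finf p q b (toC (Re z / sqn z, - Im z / sqn z))) = Arg (F p q b z).
  move=> h; have e2 : F p q b z = (sqn z)%:C * Finf p q b (toC (Re z / sqn z, - Im z / sqn z)).
    rewrite -zi -mulCJ /F /Finf.
    have -> : q - z = z * (q * z^-1 - 1) by field.
    have -> : p - z = z * (p * z^-1 - 1) by field.
    by rewrite conjM; ring.
  rewrite e2 ArgZ // => h'; apply: h.
  by rewrite /onarc e2 negrayZ.
have -> : winding v0 v1 v2 b0 b1 b2 z = H (Re z / sqn z, - Im z / sqn z).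
  rewrite /winding /H !E // => h; apply: nz; [exact: Or33|exact: Or32|exact: Or31].
exact: le_lt_trans (ler_norm _) Hlt.
Qed.

(** The winding is continuous on a component of the complement and never pi there, by
    [winding_integral]. Being above pi at z, it stays above pi on the component of z, which
    [winding_far] then bounds. *)
Lemma winding_interior (S : set pt) v0 v1 v2 b0 b1 b2 z :
  - pi < b0 < pi -> - pi < b1 < pi -> - pi < b2 < pi ->
  (forall z, S (ofC z) <-> crv v0 v1 v2 b0 b1 b2 z) ->
  ~ crv v0 v1 v2 b0 b1 b2 z -> pi < winding v0 v1 v2 b0 b1 b2 z -> interior_of S (ofC z).
Proof.
move=> hb0 hb1 hb2 ES nz wz; split; first by rewrite ES.
have [M M0 far] := winding_far v0 v1 v2 hb0 hb1 hb2.
exists M => y Ky; pose W (x : pt) := winding v0 v1 v2 b0 b1 b2 (toC x).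
have ny (x : pt) : connected_component (~` S) (ofC z) x -> ~ crv v0 v1 v2 b0 b1 b2 (toC x).
  by move=> /connected_component_sub h; rewrite -ES toCK.
have conn : connected (W @` connected_component (~` S) (ofC z)).
  apply: connected_continuous_connected; first exact: component_connected.
  apply: continuous_in_subspaceT => x; rewrite inE => hx.
  exact: continuous_winding (ny _ hx).
move/connected_intervalP: conn => itv.
suff big : ~ (W y < pi).
  have small h := big (far (toC y) (ny _ Ky) h).
  by split; rewrite leNgt; apply/negP => h; apply: small; [left|right].
move=> small.
have wz' : (W @` connected_component (~` S) (ofC z)) (W (ofC z)).
  by exists (ofC z) => //; apply: connected_component_refl; rewrite /= ES.
have wy' : (W @` connected_component (~` S) (ofC z)) (W y) by exists y.
have : (W @` connected_component (~` S) (ofC z)) pi.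
  by apply: (itv _ _ wy' wz'); rewrite (ltW small) /W ofCK (ltW wz).
move=> [x hx wx]; have := winding_integral (ny _ hx).
rewrite -/(W x) wx cispi => /eqP; rewrite -subr_eq0 -opprD oppr_eq0.
by rewrite -(natrD _ 1 1) pnatr_eq0.
Qed.

(** * The winding number close to a corner *)

Lemma lin_cvg (a b : R) : (fun r : R => r * a - b) @ (0 : R) --> (0 * a - b).
Proof. by apply: cvgB; [exact: cvgMl|exact: cvg_cst]. Qed.

(** Limit of the argument of F in [F_start] for a point approaching the start of an edge in
    direction a. *)
Lemma Arg_perturb (a b c : R) : 0 < a < 2 * pi ->
  (fun r : R => Arg ((r * c)%:C * cis b - cis (- a))) @ (0 : R) --> pi - a.
Proof.
move=> /andP[a0 a1].
have h0 : (0 * c)%:C * cis b - cis (- a) = cis (pi - a).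
  by rewrite (addrC pi) cisDpi !mul0r sub0r.
have hp : - pi < pi - a < pi by apply/andP; split; lra.
have -> : pi - a = Arg ((0 * c)%:C * cis b - cis (- a)).
  by rewrite h0 (ArgE hp (dirn_cis _)).
apply: (@continuous_Arg _ (fun r : R => (r * c)%:C * cis b - cis (- a))).
- rewrite (_ : (fun y => _) = (fun r : R => r * (c * cos b) - cos (- a))).
    have -> : Re ((0 * c)%:C * cis b - cis (- a)) = 0 * (c * cos b) - cos (- a) by rewrite !reim /=; ring.
    exact: lin_cvg.
  by apply/funext => r; rewrite !reim /=; ring.
- rewrite (_ : (fun y => _) = (fun r : R => r * (c * sin b) - sin (- a))).
    have -> : Im ((0 * c)%:C * cis b - cis (- a)) = 0 * (c * sin b) - sin (- a) by rewrite !reim /=; ring.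
    exact: lin_cvg.
  by apply/funext => r; rewrite !reim /=; ring.
- by rewrite h0; exact: (dirn_not_negray hp (dirn_cis _)).
Qed.

(* To the left of the corner at v1 the three argument variations tend to
   b1 + pi - a, b0 + pi - (L - a) and b2 + f1, whose sum is 2 pi. *)
Lemma winding_left v0 v1 v2 b0 b1 b2 f0 f1 f2 (a : R) :
  tri v0 v1 v2 b0 b1 b2 f0 f1 f2 -> b0 + b1 + b2 = pi - f0 - f1 - f2 ->
  0 < a < pi - f0 - f2 -> pi - f0 - f2 <= 2 * pi ->
  sec (fun z => pi < winding v0 v1 v2 b0 b1 b2 z) v1 (out v1 v2 b1) a a.
Proof.
move=> T sb /andP[a0 a1] L2.
have [k k0 tg] := tangent_angle T.
set L := pi - f0 - f2 in tg a1 L2.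
have ki : 0 < k^-1 by rewrite invr_gt0.
(* The winding along the ray, with the positive factors dropped inside [Arg] so that it is
   continuous up to r = 0. The edge ending at v1 is read backwards, whence the minus sign. *)
pose g (r : R) := (b0 + - (Arg ((r * k^-1)%:C * cis b0 - cis (- (a - L + 2 * pi))))) +
  (b1 + Arg ((r * 1)%:C * cis (- b1) - cis (- a))) +
  (b2 + Arg (F v2 v0 b2 (v1 + r%:C * (cis a * out v1 v2 b1)))).
have cg : g @ (0 : R) --> (b0 + - (pi - (a - L + 2 * pi))) + (b1 + (pi - a)) + (b2 + f1).
  apply: cvgD; first apply: cvgD.
  - apply: cvgD; first exact: cvg_cst.
    by apply: cvgN; apply: Arg_perturb; apply/andP; split; lra.
  - apply: cvgD; first exact: cvg_cst.
    by apply: Arg_perturb; apply/andP; split; lra.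
  - apply: cvgD; first exact: cvg_cst.
    pose l (r : R) : C := v1 + r%:C * (cis a * out v1 v2 b1).
    have l0 : l 0 = v1 by rewrite /l mul0r addr0.
    have -> : f1 = Arg (F v2 v0 b2 (l 0)) by rewrite l0 (ArgE (tri_f1 T) (tri_F2 T)).
    have cl : (fun r => ofC (l r)) @ (0 : R) --> ofC (l 0).
      have c1 : (fun r => Re (l r)) @ (0 : R) --> Re (l 0).
        rewrite (_ : (fun y => _) = (fun r : R => r * Re (cis a * out v1 v2 b1) - (- Re v1))).
          have -> : Re (l 0) = 0 * Re (cis a * out v1 v2 b1) - (- Re v1) by rewrite l0; ring.
          exact: lin_cvg.
        by apply/funext => r; rewrite /l !reim /=; ring.
      have c2 : (fun r => Im (l r)) @ (0 : R) --> Im (l 0).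
        rewrite (_ : (fun y => _) = (fun r : R => r * Im (cis a * out v1 v2 b1) - (- Im v1))).
          have -> : Im (l 0) = 0 * Im (cis a * out v1 v2 b1) - (- Im v1) by rewrite l0; ring.
          exact: lin_cvg.
        by apply/funext => r; rewrite /l !reim /=; ring.
      exact: (@cvg_pair _ _ _ _ _ _ _ _ _ _ _ c1 c2).
    apply: (@continuous_Arg _ (fun r => F v2 v0 b2 (l r))).
    + rewrite -[l 0]ofCK (_ : (fun y => _) = (fun r => Re (F v2 v0 b2 (toC (ofC (l r)))))).
        exact: (cvg_comp _ _ cl (@continuous_ReF _ v2 v0 b2 (ofC (l 0)))).
      by apply/funext => r; rewrite ofCK.
    + rewrite -[l 0]ofCK (_ : (fun y => _) = (fun r => Im (F v2 v0 b2 (toC (ofC (l r)))))).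
        exact: (cvg_comp _ _ cl (@continuous_ImF _ v2 v0 b2 (ofC (l 0)))).
      by apply/funext => r; rewrite ofCK.
    + by rewrite l0; exact: (dirn_not_negray (tri_f1 T) (tri_F2 T)).
(* The hypothesis on b0 + b1 + b2 holds modulo 2 pi in any [tri]; as an equality it selects the
   winding number 1. *)
have g0 : (b0 + - (pi - (a - L + 2 * pi))) + (b1 + (pi - a)) + (b2 + f1) = 2 * pi.
  by rewrite /L; lra.
rewrite g0 in cg.
have near : \forall r \near nbhs (0 : R), pi < g r.
  by apply: (cvgr_gt _ cg); have := pi_gt0 R; lra.
have [e /= e_0 he] := (nbhs_ballP (0 : R) _).1 near.
have hL : 0 <= L <= 2 * pi by apply/andP; split; lra.
have [e' e'0 av] : sec (fun z => ~ crv v0 v1 v2 b0 b1 b2 z) v1 (out v1 v2 b1) a a.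
  by apply: (vertex_sector T hL) => //; [lra|left].
exists (Num.min e e'); first by rewrite lt_min e_0.
move=> r a' /andP[r0]; rewrite lt_min => /andP[r1 r2] /andP[h1 h2].
have -> : a' = a by lra.
have {}av := av r a; set z := v1 + r%:C * (cis a * out v1 v2 b1) in av *.
have nz : ~ crv v0 v1 v2 b0 b1 b2 z by apply: av; rewrite ?lexx // r0.
have n0 : ~ onarc v1 v0 (- b0) z by rewrite onarc_rev => h; apply: nz; exact: Or31.
have n1 : ~ onarc v1 v2 b1 z by move=> h; apply: nz; exact: Or32.
have so v w b : v != w -> 0 < sqn (out v w b).
  by move=> vw; rewrite sqn_gt0 // mulf_neq0 ?cis_neq0 // subr_eq0 eq_sym.
have A1 : Arg (F v1 v2 b1 z) = Arg ((r * 1)%:C * cis (- b1) - cis (- a)).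
  rewrite mulr1; have s1 : 0 < r * sqn (out v1 v2 b1) by rewrite mulr_gt0 // so // (tri_v12 T).
  by move: n1; rewrite /onarc /z F_start negrayZ // => n1; rewrite ArgZ.
have A0 : Arg (F v0 v1 b0 z) = - Arg ((r * k^-1)%:C * cis b0 - cis (- (a - L + 2 * pi))).
  have zE : z = v1 + (r * k^-1)%:C * (cis (a - L) * out v1 v0 (- b0)).
    rewrite /out opprK tg /z /out RCM RCV cisD; congr (_ + _).
    transitivity (r%:C * (cis a * (cis (- b1) * (v2 - v1))) * ((k%:C)^-1 * k%:C) * (cis (- L) * cis L)); last by ring.
    by rewrite cisNK mulVf ?mulr1 // RC_neq0 gt_eqF.
  have s1 : 0 < (r * k^-1) * sqn (out v1 v0 (- b0)).
    by rewrite !mulr_gt0 // so // eq_sym (tri_v01 T).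
  rewrite -[b0 in LHS]opprK F_rev.
  have e1 : cis (- (a - L + 2 * pi)) = cis (- (a - L)) :> C by rewrite opprD cisB2pi.
  have e2 := F_start v1 v0 (- b0) (r * k^-1) (a - L).
  rewrite -zE opprK -e1 in e2.
  move: n0; rewrite /onarc e2 negrayZ // => n0.
  have n0' : ~ negray (((r / k) * sqn (out v1 v0 (- b0)))%:C * ((r / k)%:C * cis b0 - cis (- (a - L + 2 * pi)))).
    by rewrite negrayZ.
  rewrite -[in RHS](ArgZ s1 n0); apply: ArgE.
    by have /andP[? ?] := Arg_bound (((r / k) * sqn (out v1 v0 (- b0)))%:C * ((r / k)%:C * cis b0 - cis (- (a - L + 2 * pi)))); apply/andP; split; lra.
  by apply: dirnJ; apply: Arg_dirn.
have -> : winding v0 v1 v2 b0 b1 b2 z = g r by rewrite /winding A0 A1 /g /z.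
by apply: he; rewrite /ball /= sub0r normrN gtr0_norm.
Qed.

End Sufficiency.

(** * Arc-triangles with given angles *)

Section Realization.
Variable R : realType.
Local Notation C := R[i].
Local Notation Re := (@complex.Re R).
Local Notation Im := (@complex.Im R).
Local Notation pt := (pt R).
Implicit Types (K X P : C -> Prop) (v d p q z : C).

(** * Half-lines that avoid the curve and escape to infinity *)

Lemma ray_not_interior (S : set pt) z d : d != 0 ->
  (forall t : R, 0 <= t -> ~ S (ofC (z + t%:C * d))) -> ~ interior_of S (ofC z).
Proof.
move=> d0 free [nz [M bd]].
have lin (c1 c2 : R) : continuous (fun t : R => c1 + t * c2).
  by move=> t; apply: cvgD; [exact: cvg_cst|exact: cvgMl].
have M0 : 0 <= M.
  have [h _] := bd (ofC z) (connected_component_refl nz).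
  exact: le_trans (normr_ge0 _) h.
have on t : 0 <= t -> `|Re z + t * Re d| <= M /\ `|Im z + t * Im d| <= M.
  move=> t0; pose g (s : R) : pt := (Re z + s * Re d, Im z + s * Im d).
  have gE s : g s = ofC (z + s%:C * d) by rewrite /g /ofC !reim /=; congr pair; ring.
  have cg : continuous g.
    by move=> s; apply: (@cvg_pair _ _ _ _ _ _ _ _ _ _ _ (lin (Re z) (Re d) s) (lin (Im z) (Im d) s)).
  have conn : connected (g @` `[0, t]).
    apply: connected_continuous_connected; first exact: segment_connected.
    exact: continuous_subspaceT.
  have sub : g @` `[0, t] `<=` ~` S.
    by move=> x [s /=]; rewrite in_itv /= => /andP[s0 _] <-; rewrite gE; exact: free.
  have m0 : (g @` `[0, t]) (ofC z).
    exists 0; first by rewrite /= in_itv /= lexx t0.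
    by rewrite gE mul0r addr0.
  have mt : (g @` `[0, t]) (g t) by exists t => //=; rewrite in_itv /= lexx t0.
  exact: (bd (g t) ((connected_component_max m0 sub conn) _ mt)).
have big (x y : R) : y != 0 -> (forall t, 0 <= t -> `|x + t * y| <= M) -> False.
  move=> y0 h; have yp : 0 < `|y| by rewrite normr_gt0.
  have t0 : 0 <= (M + `|x| + 1) / `|y| by rewrite divr_ge0 // !addr_ge0.
  have := h _ t0; rewrite leNgt => /negP; apply.
  have := lerB_normD ((M + `|x| + 1) / `|y| * y) x.
  rewrite normrM (ger0_norm t0) divfK ?gt_eqF // [_ + x]addrC.
  have := normr_ge0 x; lra.
have [r0|r0] := eqVneq (Re d) 0; last by apply: (big (Re z) _ r0) => t /on[].
have [i0|i0] := eqVneq (Im d) 0; last by apply: (big (Im z) _ i0) => t /on[].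
by move/eqP: d0; apply; apply: complex_ext.
Qed.

Lemma escape_sec (S : set pt) K v u (a : R) : u != 0 -> (forall z, S (ofC z) <-> K z) ->
  (forall r : R, 0 < r -> ~ K (v + r%:C * (cis a * u))) ->
  sec (fun z => ~ interior_of S (ofC z)) v u a a.
Proof.
move=> u0 ES free; exists 1 => // r a' /andP[r0 _] /andP[h1 h2].
have -> : a' = a by lra.
have cu : cis a * u != 0 by rewrite mulf_neq0 // cis_neq0.
apply: (ray_not_interior cu).
move=> t t0; rewrite ES.
have -> : v + r%:C * (cis a * u) + t%:C * (cis a * u) = v + (r + t)%:C * (cis a * u).
  by rewrite RCD; ring.
by apply: free; lra.
Qed.

Lemma out_neq0 v w (b : R) : v != w -> out v w b != 0.
Proof. by move=> h; rewrite mulf_neq0 ?cis_neq0 // subr_eq0 eq_sym. Qed.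

(** One exterior ray on the right of the corner is enough: [vertex_same] spreads it over all
    directions between L and 2 pi. *)
Definition escapes (S : set pt) v u (L : R) :=
  exists2 a : R, L < a < 2 * pi & sec (fun z => ~ interior_of S (ofC z)) v u a a.

(** On the line of the chord outside the segment, p - z and q - z are positive multiples of each
    other, which gives F the constant direction - b. *)
Lemma F_chord_start p q (b r : R) :
  F p q b (p - r%:C * (q - p)) = (r * (1 + r) * sqn (q - p))%:C * cis (- b).
Proof.
rewrite /F; have -> : p - (p - r%:C * (q - p)) = r%:C * (q - p) by ring.
by rewrite conjM conj_real (RCM (r * (1 + r))) (RCM r) (RCD 1) -mulCJ; ring.
Qed.

Lemma F_chord_end p q (b r : R) :
  F p q b (q + r%:C * (q - p)) = (r * (1 + r) * sqn (q - p))%:C * cis (- b).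
Proof.
rewrite /F; have -> : p - (q + r%:C * (q - p)) = - ((1 + r)%:C * (q - p)) by rewrite RCD; ring.
by rewrite conjN conjM conj_real (RCM (r * (1 + r))) (RCM r) (RCD 1) -mulCJ; ring.
Qed.

(** f2 + b0 is the Euclidean angle at v2, and [off_range] for the direction - b0 keeps the line off
    the edge v2 v0. The edge v1 v2 is left to a hypothesis because [realizable_vertex] avoids it by
    a different argument. *)
Lemma chord_line_free v0 v1 v2 b0 b1 b2 f0 f1 f2 z (x : R) :
  tri v0 v1 v2 b0 b1 b2 f0 f1 f2 -> 0 < f2 + b0 < pi -> 0 < f2 + b0 + f1 ->
  0 < x -> F v0 v1 b0 z = x%:C * cis (- b0) -> ~ onarc v1 v2 b1 z ->
  ~ crv v0 v1 v2 b0 b1 b2 z.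
Proof.
move=> T /andP[A0 A1] h1 x0 e n1.
have Fn0 : F v0 v1 b0 z != 0 by rewrite e mulf_neq0 ?cis_neq0 // RC_neq0 gt_eqF.
case=> [on|//|on].
  have /andP[? ?] := tri_b0 T.
  have hb : - pi < - b0 < pi by apply/andP; split; lra.
  by apply: (dirn_not_negray hb _ on); exists x.
have zv : z = v0.
  apply: (F_other_adjacent_off T _ (ltW x0) e on).
  by have /andP[? ?] := tri_f1 T; split; apply/andP; split; lra.
by move: Fn0; rewrite zv /F subrr (_ : cj 0 = 0) ?mulr0 ?eqxx //; apply/eqP; rewrite conj_eq0.
Qed.

Lemma chord_line_free_adjacent v0 v1 v2 b0 b1 b2 f0 f1 f2 z (x : R) :
  tri v0 v1 v2 b0 b1 b2 f0 f1 f2 -> 0 < f2 + b0 < pi -> 0 < f2 + b0 + f0 ->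
  0 < x -> F v0 v1 b0 z = x%:C * cis (- b0) -> ~ onarc v1 v2 b1 z.
Proof.
move=> T /andP[A0 A1] h0 x0 e on.
have Fn0 : F v0 v1 b0 z != 0 by rewrite e mulf_neq0 ?cis_neq0 // RC_neq0 gt_eqF.
have zv : z = v1.
  apply: (F_adjacent_off T _ (ltW x0) e on).
  by have /andP[? ?] := tri_f0 T; split; apply/andP; split; lra.
by move: Fn0; rewrite zv /F subrr mulr0 mul0r eqxx.
Qed.

Lemma escape_start (S : set pt) v0 v1 v2 b0 b1 b2 f0 f1 f2 :
  tri v0 v1 v2 b0 b1 b2 f0 f1 f2 -> (forall z, S (ofC z) <-> crv v0 v1 v2 b0 b1 b2 z) ->
  0 < f2 + b0 < pi -> 0 < f2 + b0 + f1 ->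
  (forall r : R, 0 < r -> ~ onarc v1 v2 b1 (v0 - r%:C * (v1 - v0))) ->
  escapes S v0 (out v0 v1 b0) (pi - f1 - f2).
Proof.
move=> T ES hA h1 n1; have /andP[? ?] := tri_b0 T; have v01 := tri_v01 T.
(* The direction of v0 - v1; it lies beyond the left angle because f2 + b0 + f1 > 0. *)
exists (b0 + pi); first by apply/andP; split; lra.
apply: (escape_sec (out_neq0 _ v01) ES) => r r0.
have -> : v0 + r%:C * (cis (b0 + pi) * out v0 v1 b0) = v0 - r%:C * (v1 - v0).
  rewrite cisDpi /out.
  transitivity (v0 - r%:C * ((cis b0 * cis (- b0)) * (v1 - v0))); first by ring.
  by rewrite cisKN mul1r.
apply: (chord_line_free T hA h1 _ (F_chord_start _ _ _ _) (n1 _ r0)).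
by rewrite !mulr_gt0 ?sqn_gt0 // ?subr_eq0 1?eq_sym // ltr_wpDr // ltW.
Qed.

Lemma escape_end (S : set pt) v0 v1 v2 b0 b1 b2 f0 f1 f2 :
  tri v0 v1 v2 b0 b1 b2 f0 f1 f2 -> (forall z, S (ofC z) <-> crv v0 v1 v2 b0 b1 b2 z) ->
  0 < f2 + b0 < pi -> 0 < f2 + b0 + f0 -> 0 < f2 + b0 + f1 ->
  escapes S v1 (out v1 v2 b1) (pi - f0 - f2).
Proof.
move=> T ES hA h0 h1; have /andP[? ?] := tri_b0 T; have v01 := tri_v01 T.
have [k k0 tg] := tangent_angle T.
(* The arriving edge is at angle pi - f0 - f2, its chord at b0 less, and the prolonged chord is
   opposite to that. The angle is below 2 pi because f2 + b0 + f0 > 0. *)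
exists (pi - f0 - f2 - b0 + pi); first by apply/andP; split; lra.
apply: (escape_sec (out_neq0 _ (tri_v12 T)) ES) => r r0.
have ki : 0 < r * k^-1 by rewrite mulr_gt0 // invr_gt0.
have -> : v1 + r%:C * (cis (pi - f0 - f2 - b0 + pi) * out v1 v2 b1) =
    v1 + (r * k^-1)%:C * (v1 - v0).
  have -> : v1 - v0 = - (cis (- b0) * (cis b0 * (v0 - v1))) by rewrite mulrA cisNK; ring.
  rewrite tg cisDpi (cisD (pi - f0 - f2)) /out RCM RCV; congr (_ + _).
  transitivity (- (r%:C * ((k%:C)^-1 * k%:C) * (cis (pi - f0 - f2) * cis (- b0) * (cis (- b1) * (v2 - v1))))); last by ring.
  by rewrite mulVf ?RC_neq0 ?gt_eqF // mulr1; ring.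
have xp : 0 < r * k^-1 * (1 + r * k^-1) * sqn (v1 - v0).
  by rewrite !mulr_gt0 ?invr_gt0 ?sqn_gt0 // ?subr_eq0 1?eq_sym // ltr_wpDr // ltW.
have e := F_chord_end v0 v1 b0 (r * k^-1).
exact: (chord_line_free T hA h1 xp e (chord_line_free_adjacent T hA h0 xp e)).
Qed.

Lemma corner_realized (S : set pt) (u0 u1 u2 : pt) (e0 e1 : carc R) b2 f0 f1 f2 :
  wf_arc e0 -> wf_arc e1 -> arc_pt e0 0 = u0 -> arc_pt e0 1 = u1 ->
  arc_pt e1 0 = u1 -> arc_pt e1 1 = u2 ->
  tri (toC u0) (toC u1) (toC u2) (bulge e0) (bulge e1) b2 f0 f1 f2 ->
  bulge e0 + bulge e1 + b2 = pi - f0 - f1 - f2 -> - pi <= f2 + f0 <= pi ->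
  (forall z, S (ofC z) <-> crv (toC u0) (toC u1) (toC u2) (bulge e0) (bulge e1) b2 z) ->
  (pi - f0 - f2 < 2 * pi -> escapes S (toC u1) (out (toC u1) (toC u2) (bulge e1)) (pi - f0 - f2)) ->
  interior_angle (interior_of S) u1 (arc_tan e1 0) (neg_pt (arc_tan e0 1)) (pi - f0 - f2).
Proof.
move=> w0 w1 p0 q0 p1 q1 T sb /andP[h1 h2] ES esc.
have [k0 k00 [_ t0]] := carc_tan w0; have [k1 k10 [t1 _]] := carc_tan w1.
rewrite p0 q0 in t0; rewrite p1 q1 in t1.
have [l l0 tg] := tangent_angle T.
set L := pi - f0 - f2 in tg esc *.
have hL : 0 <= L <= 2 * pi by rewrite /L; apply/andP; split; lra.
have k1n : k1%:C != 0 :> C by rewrite RC_neq0 gt_eqF.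
have k1i : 0 < k1^-1 by rewrite invr_gt0.
split => //; left; rewrite sector_angleE.
have fr P a : sec P (toC u1) (out (toC u1) (toC u2) (bulge e1)) a a ->
    sec P (toC u1) (toC (arc_tan e1 0)) a a.
  move=> h; apply: (@sec_frame _ P _ _ (out (toC u1) (toC u2) (bulge e1)) k1 0); rewrite ?addr0 //.
  by rewrite t1 cis0 mul1r.
have sX : path_sat (crv (toC u0) (toC u1) (toC u2) (bulge e0) (bulge e1) b2) (fun z => interior_of S (ofC z)).
  move=> g a b cr ci ab av; apply: interior_path_sat => // t ht.
  by rewrite ES; exact: av.
have nX := path_sat_compl sX.
split.
- exists (k0 * l * k1^-1); first by rewrite !mulr_gt0.
  rewrite toC_neg t0 t1 !RCM RCV.
  transitivity (k0%:C * (cis (bulge e0) * (toC u0 - toC u1))); first by ring.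
  by rewrite tg; field.
- move=> a /andP[a0 a1]; apply: fr.
  have wl := winding_left T sb (introT andP (conj a0 a1)) (andP hL).2.
  have av : sec (fun z => ~ crv (toC u0) (toC u1) (toC u2) (bulge e0) (bulge e1) b2 z)
      (toC u1) (out (toC u1) (toC u2) (bulge e1)) a a.
    by apply: (vertex_sector T hL) => //; [move/andP: hL => [? ?]; lra|left].
  apply: sec_imp (sec_and wl av) => z [wz nz].
  by apply: (winding_interior _ _ _ ES nz wz); [exact: tri_b0 T|exact: tri_b1 T|exact: tri_b2 T].
- move=> a /andP[a0 a1]; apply: fr.
  have [a' /andP[a'0 a'1] s] := esc (lt_trans a0 a1).
  move/andP: (hL) => [hL0 hL1].
  apply: (vertex_same (a := a') T hL nX) => //.
  + by apply/andP; split; lra.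
  + by apply/andP; split; lra.
  + by right.
Qed.

Definition realizable (th0 th1 th2 : R) :=
  exists (v0 v1 v2 : pt) (e0 e1 e2 : carc R),
    arc_triangle v0 v1 v2 e0 e1 e2 /\ simple_triangle v0 v1 v2 e0 e1 e2 /\
    triangle_angles v0 v1 v2 e0 e1 e2 th0 th1 th2.

Lemma realizable_rot th0 th1 th2 : realizable th0 th1 th2 -> realizable th1 th2 th0.
Proof.
move=> [v0 [v1 [v2 [e0 [e1 [e2 [[[w0 w1 w2] [h0 h1 h2]] [[s0 [s1 s2]] [i0 i1 i2]]]]]]]]].
exists v1, v2, v0, e1, e2, e0; split; [by []|split; [by []|]].
have e : arc_set e1 `|` arc_set e2 `|` arc_set e0 = arc_set e0 `|` arc_set e1 `|` arc_set e2.
  by apply/seteqP; split => x /=; tauto.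
by split; rewrite e.
Qed.

Lemma crv_escapes_rot (S : set pt) v0 v1 v2 b0 b1 b2 :
  (forall z, S (ofC z) <-> crv v0 v1 v2 b0 b1 b2 z) ->
  forall z, S (ofC z) <-> crv v1 v2 v0 b1 b2 b0 z.
Proof. by move=> h z; rewrite h; apply: iff_sym; exact: crv_rot. Qed.

(** The escape hypothesis ranges over all S because the edges, and with them the curve, are only
    built in the proof. *)
Lemma tri_realizable v0 v1 v2 b0 b1 b2 f0 f1 f2 :
  tri v0 v1 v2 b0 b1 b2 f0 f1 f2 -> b0 + b1 + b2 = pi - f0 - f1 - f2 ->
  - pi <= f2 + f0 <= pi -> - pi <= f0 + f1 <= pi -> - pi <= f1 + f2 <= pi ->
  (forall S : set pt, (forall z, S (ofC z) <-> crv v0 v1 v2 b0 b1 b2 z) ->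
    [/\ pi - f1 - f2 < 2 * pi -> escapes S v0 (out v0 v1 b0) (pi - f1 - f2),
        pi - f0 - f2 < 2 * pi -> escapes S v1 (out v1 v2 b1) (pi - f0 - f2) &
        pi - f0 - f1 < 2 * pi -> escapes S v2 (out v2 v0 b2) (pi - f0 - f1)]) ->
  realizable (pi - f1 - f2) (pi - f0 - f2) (pi - f0 - f1).
Proof.
move=> T sb a20 a01 a12 esc.
have [e0 [w0 p0 q0 g0]] := carc_exists (tri_v01 T) (tri_b0 T).
have [e1 [w1 p1 q1 g1]] := carc_exists (tri_v12 T) (tri_b1 T).
have [e2 [w2 p2 q2 g2]] := carc_exists (tri_v20 T) (tri_b2 T).
have E0 z := arc_setE z w0; have E1 z := arc_setE z w1; have E2 z := arc_setE z w2.
rewrite p0 q0 !ofCK g0 in E0; rewrite p1 q1 !ofCK g1 in E1; rewrite p2 q2 !ofCK g2 in E2.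
have T1 := tri_rot T; have T2 := tri_rot T1.
set S := arc_set e0 `|` arc_set e1 `|` arc_set e2.
have ES z : S (ofC z) <-> crv v0 v1 v2 b0 b1 b2 z.
  split; first by case=> [[/E0 h|/E1 h]|/E2 h]; [exact: Or31|exact: Or32|exact: Or33].
  by case=> [/E0 h|/E1 h|/E2 h]; [left; left|left; right|right].
have ES1 := crv_escapes_rot ES; have ES2 := crv_escapes_rot ES1.
have [x0 x1 x2] := esc S ES.
have meet (e e' : carc R) v (A B : C -> Prop) :
    (forall z, arc_set e (ofC z) <-> A z) -> (forall z, arc_set e' (ofC z) <-> B z) ->
    A v -> B v -> (forall z, A z -> B z -> z = v) -> arc_set e `&` arc_set e' = [set ofC v].
  move=> hA hB av bv u; apply/seteqP; split => x /=; last by move=> ->; split; [apply/hA|apply/hB].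
  by rewrite -(toCK x) => -[/hA ax /hB bx]; rewrite (u _ ax bx).
exists (ofC v0), (ofC v1), (ofC v2), e0, e1, e2; split; first by [].
split.
  split; [|split].
  - apply: (meet _ _ _ _ _ E0 E1); [exact: onarc_end|exact: onarc_start|].
    by move=> z; exact: arcs_meet_once T a20.
  - apply: (meet _ _ _ _ _ E1 E2); [exact: onarc_end|exact: onarc_start|].
    by move=> z; exact: arcs_meet_once T1 a01.
  - apply: (meet _ _ _ _ _ E2 E0); [exact: onarc_end|exact: onarc_start|].
    by move=> z; exact: arcs_meet_once T2 a12.
have r1 : pi - f2 - f1 = pi - f1 - f2 by ring.
have r2 : pi - f1 - f0 = pi - f0 - f1 by ring.
split; rewrite -/S.
- rewrite -r1; apply: (@corner_realized S (ofC v2) (ofC v0) (ofC v1) e2 e0 b1 f2 f0 f1) => //; rewrite ?ofCK ?g0 ?g2 //.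
    by rewrite -(addrC b1) -addrA addrC; lra.
  by rewrite r1.
- by apply: (@corner_realized S (ofC v0) (ofC v1) (ofC v2) e0 e1 b2 f0 f1 f2) => //; rewrite ?ofCK ?g0 ?g1.
- rewrite -r2; apply: (@corner_realized S (ofC v1) (ofC v2) (ofC v0) e1 e2 b0 f1 f2 f0) => //; rewrite ?ofCK ?g1 ?g2 //.
    by lra.
  by rewrite r2.
Qed.

(* Vertices 0, sin A2 and sin A1 * cis A0, by the law of sines. *)
Lemma tri_exists (A0 A1 A2 f0 f1 f2 : R) : 0 < A0 -> 0 < A1 -> 0 < A2 -> A0 + A1 + A2 = pi ->
  - pi < A0 - f0 < pi -> - pi < A1 - f1 < pi -> - pi < A2 - f2 < pi ->
  - pi < f0 < pi -> - pi < f1 < pi -> - pi < f2 < pi ->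
  exists v0 v1 v2, tri v0 v1 v2 (A2 - f2) (A0 - f0) (A1 - f1) f0 f1 f2 /\
    0 < Im ((v2 - v0) * cj (v1 - v0)).
Proof.
move=> A00 A10 A20 sA hb1 hb2 hb0 hf0 hf1 hf2.
have s0 : 0 < sin A0 by apply: sin_gt0_pi; apply/andP; split; lra.
have s1 : 0 < sin A1 by apply: sin_gt0_pi; apply/andP; split; lra.
have s2 : 0 < sin A2 by apply: sin_gt0_pi; apply/andP; split; lra.
pose v1 : C := (sin A2)%:C; pose v2 : C := (sin A1)%:C * cis A0.
have v21 : v2 - v1 = - ((sin A0)%:C * cis (- A1)).
  have -> : v1 = (sin (A0 + A1))%:C.
    by rewrite /v1 (_ : A0 + A1 = pi - A2); [rewrite sinB cospi sinpi; congr (_%:C); ring|lra].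
  by rewrite /v2 sinD; apply: complex_ext; rewrite !reim /= ?cosN ?sinN; ring.
have n1 : v1 != 0 by rewrite RC_neq0 gt_eqF.
have n2 : v2 != 0 by rewrite mulf_neq0 ?cis_neq0 // RC_neq0 gt_eqF.
have n3 : v2 - v1 != 0 by rewrite v21 oppr_eq0 mulf_neq0 ?cis_neq0 // RC_neq0 gt_eqF.
exists 0, v1, v2; split; last first.
  rewrite !subr0 /v1 /v2 conj_real.
  have -> : Im ((sin A1)%:C * cis A0 * (sin A2)%:C) = sin A1 * sin A0 * sin A2 by rewrite !reim /=; ring.
  by rewrite !mulr_gt0.
split => //; first by rewrite eq_sym.
  by rewrite -subr_eq0 -oppr_eq0 opprB.
- exists (sin A0 * sin A1); first by rewrite mulr_gt0.
  rewrite /F -[v1 - v2]opprB v21 opprK sub0r conjN /v2 conjM conj_real conj_cis RCM.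
  have -> : cis f2 = - (cis (- (A2 - f2)) * cis (- A1) * cis (- A0)) :> C.
    by rewrite -!cisD -cisDpi; congr cis; lra.
  by ring.
- exists (sin A1 * sin A2); first by rewrite mulr_gt0.
  rewrite /F !subr0 /v1 /v2 conj_real RCM.
  have -> : cis f0 = cis (- (A0 - f0)) * cis A0 :> C by rewrite -cisD; congr cis; ring.
  by ring.
- exists (sin A2 * sin A0); first by rewrite mulr_gt0.
  rewrite /F v21 conjN conjM conj_real conj_cis opprK sub0r /v1 RCM.
  have -> : cis f1 = cis (- (A1 - f1)) * cis A1 :> C by rewrite -cisD; congr cis; ring.
  by ring.
Qed.

(** An isosceles triangle with apex v2, so that only A2 is chosen: above - f0 and - f1 for the
    prolonged chord to escape on the right at both ends, below pi + f2 for the bulge of the edge v0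
    v1. The last two hypotheses make this range nonempty. *)
Lemma edge_angles_exist (f0 f1 f2 : R) :
  - pi < f0 < pi -> - pi < f1 < pi -> - pi < f2 < pi ->
  - pi < f2 + f0 -> - pi < f1 + f2 ->
  exists A0 A2 : R, [/\ 0 < A0, 0 < A2, A0 + A0 + A2 = pi,
    - pi < A0 - f0 < pi & - pi < A0 - f1 < pi] /\
    [/\ - pi < A2 - f2 < pi, 0 < f2 + (A2 - f2) < pi,
    0 < f2 + (A2 - f2) + f0 & 0 < f2 + (A2 - f2) + f1].
Proof.
move=> /andP[g0 g0'] /andP[g1 g1'] /andP[g2 g2'] c0 c1; have pp := pi_gt0 R.
pose lo := Num.max 0 (Num.max (- f0) (- f1)); pose hi := Num.min pi (pi + f2).
have lh : lo < hi by rewrite /lo /hi !gt_max !lt_min; apply/and3P; split; apply/andP; split; lra.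
have [l0 l1 l2] : [/\ 0 <= lo, - f0 <= lo & - f1 <= lo] by split; rewrite /lo !le_max lexx ?orbT.
have [m0 m1] : hi <= pi /\ hi <= pi + f2 by split; rewrite /hi !ge_min lexx ?orbT.
clearbody lo hi; exists ((pi - (lo + hi) / 2) / 2), ((lo + hi) / 2).
by split; split; try (apply/andP; split); lra.
Qed.

(** The angles at v0 and v1 are below 2 pi, and the chord of v0 v1 escapes at both ends. Its line
    misses v2, which gets exterior points from v1 by [right_transfer] along the edge v1 v2. *)
Lemma realizable_edge (f0 f1 f2 : R) :
  - pi < f0 < pi -> - pi < f1 < pi -> - pi < f2 < pi ->
  - pi <= f2 + f0 <= pi -> - pi <= f0 + f1 <= pi -> - pi <= f1 + f2 <= pi ->
  - pi < f2 + f0 -> - pi < f1 + f2 ->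
  realizable (pi - f1 - f2) (pi - f0 - f2) (pi - f0 - f1).
Proof.
move=> hf0 hf1 hf2 a20 a01 a12 c0 c1.
have [A0 [A2 [[A00 A20 sA b1P b2P] [b0P hA h0 h1]]]] := edge_angles_exist hf0 hf1 hf2 c0 c1.
have [v0 [v1 [v2 [T _]]]] := tri_exists A00 A00 A20 sA b1P b2P b0P hf0 hf1 hf2.
apply: (tri_realizable T) => //; first by clear -sA; lra.
move=> S ES.
have x0 : escapes S v0 (out v0 v1 (A2 - f2)) (pi - f1 - f2).
  apply: (escape_start T ES hA h1) => r r0.
  apply: (chord_line_free_adjacent T hA h0 _ (F_chord_start _ _ _ _)).
  by rewrite !mulr_gt0 ?sqn_gt0 // ?subr_eq0 1?eq_sym ?(tri_v01 T) // ltr_wpDr // ltW.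
have x1 := escape_end T ES hA h0 h1.
split => // c2; have [a /andP[a0 a1] xa] := x1.
have r1 : pi - f2 - f0 = pi - f0 - f2 by ring.
have r2 : pi - f1 - f0 = pi - f0 - f1 by ring.
move/andP: a01 => [_ p01]; move/andP: a20 => [_ p20].
have [n1 n2] : 0 <= pi - f0 - f2 /\ 0 <= pi - f0 - f1 by clear -p01 p20; split; lra.
have [n3 n4] : pi - f0 - f1 < (pi - f0 - f1 + 2 * pi) / 2 /\
    (pi - f0 - f1 + 2 * pi) / 2 < 2 * pi by clear -c2; split; lra.
exists ((pi - f0 - f1 + 2 * pi) / 2); first by rewrite n3 n4.
have nX : path_sat (crv v0 v1 v2 (A2 - f2) (A0 - f0) (A0 - f1)) (fun z => ~ interior_of S (ofC z)).
  apply: path_sat_compl => g x y cr ci xy av; apply: interior_path_sat => // t ht.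
  by rewrite ES; exact: av.
apply: (right_transfer (a := a) (tri_rot T) (path_sat_rot nX)) => //.
  by rewrite r1 n1.
by rewrite r2 n2.
Qed.

(** The equations say that the angles at v1 and v2 are 2 pi and give f1 = f2 = - pi - f0. An escape
    at v0 asks for B + f1 > 0, that is A < - pi - 2 f0; the bulge of the edge v1 v2 asks for A < pi
    + f0. *)
Lemma vertex_angles_exist (f0 f1 f2 : R) :
  - pi < f0 < pi -> - pi <= f1 + f2 -> f2 + f0 = - pi -> f0 + f1 = - pi ->
  exists A B : R, [/\ 0 < A, 0 < B, A + B + B = pi,
    - pi < A - f0 < pi & - pi < B - f1 < pi] /\
    [/\ - pi < B - f2 < pi, 0 < A - f0 < pi, 0 < f2 + (B - f2) < pi &
    pi - f1 - f2 < 2 * pi -> 0 < f2 + (B - f2) + f1].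
Proof.
move=> /andP[g0 g0'] h c0 c1; have pp := pi_gt0 R.
have [A [A0 A1 A2 A3]] : exists A, [/\ 0 < A, A < pi, A < pi + f0 & f0 < - pi / 2 -> A < - pi - 2 * f0].
  (* The bound on f1 + f2 gives f0 <= - pi / 2. In case of equality the angle at v0 is 2 pi as well,
     and no escape is asked for. *)
  have [e|e] := leP (- pi / 2) f0; first by exists (pi / 3); split; lra.
  have [m0 m1] : 0 < pi + f0 /\ 0 < - pi - 2 * f0 by split; lra.
  case: (leP (pi + f0) (- pi - 2 * f0)) => m2; [exists ((pi + f0) / 2)|exists ((- pi - 2 * f0) / 2)];
    by split; lra.
exists A, ((pi - A) / 2).
by split; split; try (apply/andP; split); lra.
Qed.

Lemma realizable_vertex (f0 f1 f2 : R) :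
  - pi < f0 < pi -> - pi < f1 < pi -> - pi < f2 < pi ->
  - pi <= f2 + f0 <= pi -> - pi <= f0 + f1 <= pi -> - pi <= f1 + f2 <= pi ->
  f2 + f0 = - pi -> f0 + f1 = - pi ->
  realizable (pi - f1 - f2) (pi - f0 - f2) (pi - f0 - f1).
Proof.
move=> hf0 hf1 hf2 a20 a01 a12 c0 c1; have [d1 _] := andP a12.
have [A [B [[A0 B0 sA b1P b2P] [b0P hb hA esc]]]] := vertex_angles_exist hf0 d1 c0 c1.
have [v0 [v1 [v2 [T im]]]] := tri_exists A0 B0 B0 sA b1P b2P b0P hf0 hf1 hf2.
apply: (tri_realizable T) => //; first by clear -sA; lra.
move=> S ES; split; [move=> /esc h|by clear -c0; lra|by clear -c1; lra].
(* Since B + f0 < 0, the [off_range] criterion fails for the edge v1 v2. But its bulge A - f0 lies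
   in ]0, pi[, so it stays on the side of its chord away from v0, whereas the chord v0 v1 prolonged
   beyond v0 stays strictly on the side of v0. *)
apply: (escape_start T ES hA h) => r r0 /negrayP[x x0 e].
have sb : 0 < sin (A - f0) by apply: sin_gt0_pi.
set z := v0 - r%:C * (v1 - v0) in e.
have e1 : (v2 - z) * cj (v1 - z) = - (x%:C * cis (A - f0)).
  have : cis (A - f0) * F v1 v2 (A - f0) z = cis (A - f0) * (- x%:C) by rewrite e.
  by rewrite /F !mulrA cisKN mul1r => ->; ring.
have e2 : (v2 - z) * cj (v1 - z) =
    (1 + r)%:C * ((v2 - v0) * cj (v1 - v0) + (r * sqn (v1 - v0))%:C).
  have -> : v1 - z = (1 + r)%:C * (v1 - v0) by rewrite /z RCD; ring.
  have -> : v2 - z = (v2 - v0) + r%:C * (v1 - v0) by rewrite /z; ring.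
  by rewrite conjM conj_real RCM -mulCJ; ring.
have : Im ((v2 - z) * cj (v1 - z)) <= 0.
  rewrite e1 ImN ImM /= mul0r addr0 oppr_le0 mulr_ge0 //; exact: ltW.
rewrite e2 ImM [Im (_%:C)]/= mul0r addr0 ImD [Im (_%:C)]/= addr0.
by rewrite leNgt => /negP; apply; rewrite mulr_gt0 //= ltr_wpDr // ltW.
Qed.

End Realization.

Theorem mainTheorem4 (R : realType) (th0 th1 th2 : R)
  (h0 : 0 <= th0 <= 2 * pi) (h1 : 0 <= th1 <= 2 * pi) (h2 : 0 <= th2 <= 2 * pi) :
  let psi := (pi - th0 - th1 - th2) / 2 in
  (exists (v0 v1 v2 : pt R) (e0 e1 e2 : carc R),
     arc_triangle v0 v1 v2 e0 e1 e2 /\ simple_triangle v0 v1 v2 e0 e1 e2 /\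
     triangle_angles v0 v1 v2 e0 e1 e2 th0 th1 th2)
  <->
  [/\ - pi < psi + th0 < pi, - pi < psi + th1 < pi & - pi < psi + th2 < pi].
Proof.
move=> psi; split.
  by move=> [v0 [v1 [v2 [e0 [e1 [e2 [tr [si an]]]]]]]]; exact: angles_bounded tr si an.
move=> [hf0 hf1 hf2]; change (realizable th0 th1 th2).
have E0 : th0 = pi - (psi + th1) - (psi + th2) by rewrite /psi; lra.
have E1 : th1 = pi - (psi + th0) - (psi + th2) by rewrite /psi; lra.
have E2 : th2 = pi - (psi + th0) - (psi + th1) by rewrite /psi; lra.
move: E0 E1 E2 hf0 hf1 hf2; set f0 := psi + th0; set f1 := psi + th1; set f2 := psi + th2.
clearbody f0 f1 f2; move=> E0 E1 E2 hf0 hf1 hf2.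
move/andP: h0 => [h0 h0']; move/andP: h1 => [h1 h1']; move/andP: h2 => [h2 h2'].
have a20 : - pi <= f2 + f0 <= pi by apply/andP; split; lra.
have a02 : - pi <= f0 + f2 <= pi by rewrite addrC.
have a01 : - pi <= f0 + f1 <= pi by apply/andP; split; lra.
have a10 : - pi <= f1 + f0 <= pi by rewrite addrC.
have a12 : - pi <= f1 + f2 <= pi by apply/andP; split; lra.
have a21 : - pi <= f2 + f1 <= pi by rewrite addrC.
have S0 : pi - f2 - f1 = th0 by lra.
have S1 : pi - f2 - f0 = th1 by lra.
have S2 : pi - f1 - f0 = th2 by lra.
(* Cyclic relabelings that bring the distinguished edge or vertex to v0 v1 or v0. *)
have L0 : realizable (pi - f1 - f2) (pi - f0 - f2) (pi - f0 - f1) -> realizable th0 th1 th2.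
  by rewrite -E0 -E1 -E2.
have L1 : realizable (pi - f2 - f0) (pi - f1 - f0) (pi - f1 - f2) -> realizable th0 th1 th2.
  by rewrite S1 S2 -E0 => /realizable_rot /realizable_rot.
have L2 : realizable (pi - f0 - f1) (pi - f2 - f1) (pi - f2 - f0) -> realizable th0 th1 th2.
  by rewrite -E2 S0 S1 => /realizable_rot.
have lo (x : R) : - pi <= x <= pi -> x != - pi -> - pi < x.
  by move=> /andP[h _] n; rewrite lt_neqAle eq_sym n h.
(* A sum equal to - pi is an angle 2 pi at the remaining vertex. With at most one of them some edge
   has both end angles below 2 pi; with two or three, [realizable_vertex] applies. *)
have [c20|/(lo _ a20) c20] := eqVneq (f2 + f0) (- pi);
  have [c01|/(lo _ a01) c01] := eqVneq (f0 + f1) (- pi);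
  have [c12|/(lo _ a12) c12] := eqVneq (f1 + f2) (- pi).
- by apply: L0; apply: realizable_vertex.
- by apply: L0; apply: realizable_vertex.
- by apply: L2; apply: realizable_vertex.
- by apply: L2; apply: realizable_edge.
- by apply: L1; apply: realizable_vertex.
- by apply: L0; apply: realizable_edge.
- by apply: L1; apply: realizable_edge.
- by apply: L0; apply: realizable_edge.
Qed.
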